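(* Let $\tau\in(3,4)$ and let $\boldsymbol\theta=(\theta_i)_{i\ge1}\in\ell^3_\downarrow\setminus\ell^2_\downarrow$ be such that there exist constants $c_0>0$ and $c_1>1$ with $$x^{\tau-2}\sum_{i=1}^\infty\theta_i\,\mathbf 1\{x<\theta_i\le c_1x\}\ \ge\ c_0\qquad\text{for all }x\in(0,\theta_1).$$ Then there exists a sequence of degree sequences $(\boldsymbol d_n)_{n\ge1}$ satisfying Assumption 1(i) (with this $\boldsymbol\theta$), Assumption 1(ii), Assumption 2, and $$\lim_{n\to\infty}\frac{\sum_{i\in[n]}d_i(d_i-1)}{\sum_{i\in[n]}d_i}=\nu\quad\text{for some }\nu>1.$$
   Context: Set $\alpha=1/(\tau-1)$. $\ell^p_\downarrow=\{(x_i)_{i\ge1}:x_1\ge x_2\ge\cdots,\ \sum_i x_i^p<\infty\}$. For each $n$, a degree sequence is $\boldsymbol d_n=(d_1,\dots,d_n)$, a non-increasing sequence of non-negative integers (dependence on $n$ suppressed), with $\ell_n=\sum_{i\in[n]}d_i$ even. Assumption 1. (i) For each fixed $i\ge1$, $n^{-\alpha}d_i\to\theta_i$ as $n\to\infty$. (ii) Let $D_n$ be the degree of a uniformly chosen vertex of $[n]$ (i.e. $D_n=d_U$ with $U$ uniform on $[n]$). Then $D_n$ converges in distribution to some discrete random variable $D$, with $\mathbb E[D_n]=\frac1n\sum_i d_i\to\mu:=\mathbb E[D]$, $\mathbb E[D_n^2]=\frac1n\sum_i d_i^2\to\mu_2:=\mathbb E[D^2]$, and $\lim_{K\to\infty}\limsup_{n\to\infty}n^{-3\alpha}\sum_{i=K+1}^n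 d_i^3=0$. Assumption 2. Let $V_n^*$ be random with $\mathbb P(V_n^*=i)=d_i/\ell_n$, and let $D_n^*=d_{V_n^*}$. There exist constants $c_0'>0$ and $c_1'>1$ (not necessarily equal to the constants $c_0,c_1$ above) such that for all $n\ge1$, $\mathbb P(l<D_n^*\le c_1' l)\ge c_0'/l^{\tau-2}$ for $1\le l<d_1$. *)

(* Defs.v *)
From HB Require Import structures.
From mathcomp Require Import all_boot all_order all_algebra.
From mathcomp Require Import all_classical all_reals all_analysis.

Set Implicit Arguments.
Unset Strict Implicit.
Unset Printing Implicit Defensive.

Import Order.TTheory GRing.Theory Num.Theory.
Import numFieldTopology.Exports numFieldNormedType.Exports.

Local Open Scope classical_set_scope.
Local Open Scope ring_scope.

(* All sequences are indexed from 0: theta_{i+1} is [theta i], the vertex set  *)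
(* [n] is {0, ..., n - 1}, and d_{i+1} is [nth 0%N d i].                       *)

(* The usual cone of non-negative non-increasing sequences; without            *)
(* non-negativity the summability condition would be void for odd p.           *)
Definition ell_down (R : realType) (p : nat) : set (nat -> R) :=
  [set x | [/\ forall i, 0 <= x i, nonincreasing_seq x &
               (\sum_(0 <= i <oo) (x i ^+ p)%:E < +oo)%E]].

Definition alpha (R : realType) (tau : R) : R := (tau - 1)^-1.

Definition degree_sequence (n : nat) (d : n.-tuple nat) : Prop :=
  sorted geq d /\ ~~ odd (sumn d).

(* Law of a random index in {0, ..., n - 1} equal to i with probability        *)
(* w i / \sum_(j < n) w j (by convention the Dirac mass at 0 when the total    *)
(* weight is 0).                                                               *)
Definition weighted_index (R : realType) (n : nat) (w : nat -> nat) :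
    probability nat R :=
  mnormalize (msum (fun i : nat => mscale (w i)%:R%:nng (dirac i)) n)
             (dirac 0%N).

Definition uniform_vertex (R : realType) (n : nat) : probability nat R :=
  weighted_index R n (fun=> 1%N).

Definition size_biased_vertex (R : realType) (n : nat) (d : n.-tuple nat) :
    probability nat R :=
  weighted_index R n (nth 0%N d).

(* As a random variable, this is D_n under [uniform_vertex R n], and D_n^*     *)
(* under [size_biased_vertex R d].                                             *)
Definition deg (R : realType) (n : nat) (d : n.-tuple nat) : nat -> R :=
  fun i => (nth 0%N d i)%:R.

Lemma measurable_deg (R : realType) (n : nat) (d : n.-tuple nat) :
  measurable_fun [set: nat] (deg R d).
Proof. by []. Qed.

HB.instance Definition _ (R : realType) (n : nat) (d : n.-tuple nat) :=
  isMeasurableFun.Build _ _ nat R (deg R d) (@measurable_deg R n d).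

Definition cvg_in_distribution (R : realType)
    (dn : nat -> measure_display) (Tn : forall n, measurableType (dn n))
    (Pn : forall n, probability (Tn n) R) (Xn : forall n, {RV (Pn n) >-> R})
    (disp : measure_display) (T : measurableType disp) (P : probability T R)
    (X : {RV P >-> R}) : Prop :=
  forall x : R, {for x, continuous (cdf X)} ->
    cdf (Xn n) x @[n --> \oo] --> cdf X x.

Definition assumption1_i (R : realType) (tau : R) (theta : nat -> R)
    (d : forall n, n.-tuple nat) : Prop :=
  forall i : nat,
    n%:R `^ (- alpha tau) * deg R (d n) i @[n --> \oo] --> theta i.

Definition assumption1_ii (R : realType) (tau : R)
    (d : forall n, n.-tuple nat) : Prop :=
  (exists (disp : measure_display) (T : measurableType disp)
          (P : probability T R) (D : {dRV P >-> R}) (mu mu2 : R),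
    [/\ cvg_in_distribution
          (Pn := uniform_vertex R) (fun n => deg R (d n)) (D : {RV P >-> R}),
        ('E_P[D] = mu%:E)%E,
        ('E_P[(fun t => D t ^+ 2)%R] = mu2%:E)%E,
        ('E_(uniform_vertex R n)[deg R (d n)])%E @[n --> \oo] --> mu%:E &
        ('E_(uniform_vertex R n)[(fun v => deg R (d n) v ^+ 2)%R])%E @[n --> \oo]
          --> mu2%:E]) /\
  limn_esup (fun n : nat =>
    (n%:R `^ (- (3 * alpha tau)) * \sum_(K <= i < n) deg R (d n) i ^+ 3)%:E)
    @[K --> \oo] --> (0%E : \bar R).

(* The clause 0 < ell_n is what makes V_n^* well defined; l ranges over the    *)
(* reals.                                                                      *)
Definition assumption2 (R : realType) (tau : R)
    (d : forall n, n.-tuple nat) : Prop :=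
  exists c0 c1 : R, [/\ 0 < c0, 1 < c1 &
    forall n : nat, (1 <= n)%N ->
      (0 < sumn (d n))%N /\
      forall l : R, 1 <= l -> l < deg R (d n) 0 ->
        ((c0 / l `^ (tau - 2))%:E <=
         size_biased_vertex R (d n)
           [set v | (l < deg R (d n) v <= c1 * l)%R])%E].

(* Main.v *)
(* Let N = n^alpha and q = 2^(1 - tau), so that 1/8 < q < 1/4.  Pick k = k_n    *)
(* tending to infinity slowly.  The first k vertices get degrees N * theta_i,  *)
(* up to an error of at most 2.  The remaining degrees are sampled from the    *)
(* discrete power law P(D = 4 * 2^m) = (1 - q) q^m, truncated at the level     *)
(* 4 * 2^M ~ N * theta_k where the first k degrees take over: the value        *)
(* 4 * 2^m is given to floor (n (1 - q) q^m) vertices for 1 <= m <= M, and the *)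
(* value 4 to all the others.  As k grows slowly and tau > 3, the first k      *)
(* vertices do not contribute to the limits of the first two moments, while    *)
(* the third moment of the truncated part is of order N^3 theta_k^(4 - tau),   *)
(* which is negligible since theta_k -> 0.  For the lower bound on the         *)
(* size-biased mass at scale l, use a block when l < 4 * 2^M, and the          *)
(* hypothesis on theta at x ~ l / N otherwise.  All degrees are even, so their *)
(* sum is even, and at least 4, so nu >= 3.                                    *)

Require Import Defs.
From HB Require Import structures.
From mathcomp Require Import all_boot all_order all_algebra.
From mathcomp Require Import all_classical all_reals all_analysis.
From mathcomp Require Import zify ring lra.
Import Order.TTheory GRing.Theory Num.Theory.
Import numFieldTopology.Exports numFieldNormedType.Exports.
Local Open Scope classical_set_scope.
Local Open Scope ring_scope.

(** * Laws on the natural numbers *)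

(** The two families of degrees fit together because $N^{\tau-1}=n$. The power law puts about $n
    p^{1-\tau}=(N/p)^{\tau-1}$ vertices near degree $p$. The hypothesis on [theta] asks for at least
    about $x^{1-\tau}$ entries near $x$, which is the same order at $x=p/N$. So the families can be
    glued at any level. The gluing level has to be negligible against $N$, yet the head must stay
    cheap. For a fixed number $k$ of head vertices, their share of $\sum_i d_i^2$ is of order
    $kN^2$, which is $o(n)$ because $\tau>3$. [diagonal_choice] and [exists_interpolation] turn this
    into a sequence with $k_n\to\infty$. Three estimates then carry the proof.
    [degree_list_mean_error] compares the average of $F(d_i)$ with an expectation under the limit
    law, for every $F$ with $0\le F(x)\le x^2$; through [interpolates_mean_cvg] this gives
    convergence in law, both moments and $\nu$. [interpolates_third_moment] bounds the cubes by a
    tail of $\sum_i\theta_i^3$ plus a term that vanishes with $\theta_k$. [interpolates_power_law]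
    gives the size-biased bound for all large $n$; the finitely many other $n$ get the constant
    sequence 2. *)

Lemma integral_mnormalize (R : realType) (mu : {measure set nat -> \bar R})
    (P : probability nat R) (s : R) (f : nat -> \bar R) :
  0 < s -> mu setT = s%:E -> (forall x, 0 <= f x)%E ->
  (\int[mnormalize mu P]_x f x = (s^-1)%:E * \int[mu]_x f x)%E.
Proof.
move=> s0 mus f0; have si : 0 <= s^-1 by rewrite invr_ge0 ltW.
rewrite (@eq_measure_integral _ _ _ setT (mscale (NngNum si) mu)) => [|A mA _].
  by rewrite ge0_integral_mscale.
by rewrite /= /mnormalize/= mus eqe gt_eqF//= /mscale/= muleC.
Qed.

Lemma integral_weighted_index (R : realType) (n : nat) (w : nat -> nat)
    (f : nat -> R) :
  (0 < \sum_(i < n) w i)%N -> (forall i, 0 <= f i) ->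
  (\int[weighted_index R n w]_i (f i)%:E)%E
    = ((\sum_(i < n) (w i)%:R * f i) / (\sum_(i < n) w i)%:R)%:E.
Proof.
move=> w0 f0.
rewrite (@integral_mnormalize _ _ _ (\sum_(i < n) w i)%:R) ?ltr0n//; last first.
  rewrite /= /msum natr_sum -sumEFin; apply: eq_bigr => i _.
  by rewrite /= /mscale [X in (_ * X)%E](diracT R) mule1.
rewrite ge0_integral_measure_sum//=; last by move=> x _; rewrite lee_fin.
rewrite [X in (_ * X)%E](_ : _ = (\sum_(i < n) (w i)%:R * f i)%:E).
  by rewrite -EFinM mulrC.
rewrite -sumEFin; apply: eq_bigr => i _.
rewrite ge0_integral_mscale//=; last by move=> x _; rewrite lee_fin.
by rewrite integral_dirac//= diracT mul1e.
Qed.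

Lemma expectation_uniform_vertex (R : realType) (n : nat) (f : nat -> R) :
  (0 < n)%N -> (forall i, 0 <= f i) ->
  'E_(uniform_vertex R n)[f]%E = (n%:R^-1 * \sum_(i < n) f i)%:E.
Proof.
move=> n0 f0; rewrite unlock integral_weighted_index ?sum1_card ?card_ord//.
by rewrite mulrC; congr (_ * _)%:E; apply: eq_bigr => i _; rewrite mul1r.
Qed.

Lemma probability_integral_indic (R : realType) (P : probability nat R)
    (A : set nat) :
  P A = (\int[P]_x (\1_A x)%:E)%E.
Proof. by rewrite integral_indic// setIT. Qed.

(** This supplies the limit law. The conclusion is about integrals because only expectations of
    nonnegative functions are taken later, including those of indicators. *)
Lemma probability_of_weights (R : realType) (p : nat -> R) :
  (forall m, 0 <= p m) -> (\sum_(0 <= m <oo) (p m)%:E = 1)%E ->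
  exists P : probability nat R, forall f : nat -> R, (forall m, 0 <= f m) ->
    (\int[P]_m (f m)%:E = \sum_(0 <= m <oo) (p m * f m)%:E)%E.
Proof.
move=> p0 p1.
pose mu := mseries
  (fun m => mscale (NngNum (p0 m)) (dirac m : {measure set nat -> \bar R})) 0.
exists (mnormalize mu (dirac 0%N)) => f f0.
rewrite (@integral_mnormalize _ _ _ 1)//; last first.
  rewrite -p1 /= /mseries; apply: eq_eseriesr => m _.
  by rewrite /= /mscale [X in (_ * X)%E](diracT R) mule1.
rewrite invr1 mul1e ge0_integral_measure_series//; last by move=> x _; rewrite lee_fin.
apply: eq_eseriesr => m _.
rewrite ge0_integral_mscale//=; last by move=> x _; rewrite lee_fin.
by rewrite integral_dirac//= diracT mul1e.
Qed.

(** * Dyadic degree lists *)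

(* An even integer in the interval (y, y + 2]. *)
Definition even_above (R : realType) (y : R) : nat :=
  (2 * (Num.truncn (y / 2)%R).+1)%N.

Lemma even_above_itv (R : realType) (y : R) : 0 <= y ->
  y < (even_above R y)%:R <= y + 2.
Proof.
move=> y0; have /andP[] : (Num.truncn (y / 2))%:R <= y / 2 < (Num.truncn (y / 2)).+1%:R.
  by apply: truncn_itv; lra.
rewrite /even_above natrM; set t := Num.truncn _ => t1.
rewrite -(natr1 t) => t2; apply/andP; split; lra.
Qed.

Lemma even_above_le (R : realType) (x y : R) : x <= y ->
  (even_above R x <= even_above R y)%N.
Proof.
by move=> xy; rewrite leq_mul2l ltnS le_truncn//= ler_pM2r// invr_gt0.
Qed.

(** The recursion emits the largest value first, so that the list is non-increasing. The value 4, at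
    exponent 0, is left to the filler of [degree_list]. *)
Fixpoint dyadic_blocks (c : nat -> nat) (M : nat) : seq nat :=
  if M is m.+1 then nseq (c M) (4 * 2 ^ M)%N ++ dyadic_blocks c m else [::].

(** The length of the filler is a truncated subtraction, so the list is sure to have length [n] only
    when head and blocks fit, which [block_sizes_fit] guarantees. *)
Definition degree_list (h c : nat -> nat) (n k M : nat) : seq nat :=
  [seq h i | i <- iota 0 k] ++ dyadic_blocks c M ++
  nseq (n - k - \sum_(1 <= m < M.+1) c m)%N 4%N.

Lemma sum_dyadic_blocks (R : realType) (c : nat -> nat) (M : nat) (F : nat -> R) :
  \sum_(x <- dyadic_blocks c M) F x
    = \sum_(1 <= m < M.+1) (c m)%:R * F (4 * 2 ^ m)%N.
Proof.
elim: M => [|M IH]; first by rewrite big_nil big_geq.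
rewrite big_nat_recr//= big_cat/= IH addrC; congr (_ + _).
by rewrite big_nseq iter_addr_0 mulr_natl.
Qed.

Lemma size_dyadic_blocks (c : nat -> nat) (M : nat) :
  size (dyadic_blocks c M) = (\sum_(1 <= m < M.+1) c m)%N.
Proof.
elim: M => [|M IH]; first by rewrite big_geq.
by rewrite big_nat_recr//= size_cat size_nseq IH addnC.
Qed.

Lemma size_degree_list (h c : nat -> nat) (n k M : nat) :
  (k + \sum_(1 <= m < M.+1) c m <= n)%N -> size (degree_list h c n k M) = n.
Proof.
move=> le_n; rewrite /degree_list !size_cat size_map size_iota.
rewrite size_dyadic_blocks size_nseq; lia.
Qed.

Lemma sum_degree_list (R : realType) (h c : nat -> nat) (n k M : nat)
    (F : nat -> R) :
  (k + \sum_(1 <= m < M.+1) c m <= n)%N ->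
  \sum_(x <- degree_list h c n k M) F x
    = \sum_(0 <= i < k) F (h i)
      + \sum_(1 <= m < M.+1) (c m)%:R * F (4 * 2 ^ m)%N
      + (n%:R - k%:R - \sum_(1 <= m < M.+1) (c m)%:R) * F 4%N.
Proof.
move=> le_n; rewrite /degree_list !big_cat/= sum_dyadic_blocks addrA.
rewrite big_map /index_iota subn0; congr (_ + _).
rewrite big_nseq iter_addr_0 -(mulr_natl (F 4%N)).
rewrite -natr_sum; set S := (\sum_(1 <= m < M.+1) c m)%N in le_n *.
rewrite natrB; last by lia.
by rewrite natrB//; lia.
Qed.

Lemma nth_degree_list (h c : nat -> nat) (n k M i : nat) : (i < k)%N ->
  nth 0%N (degree_list h c n k M) i = h i.
Proof.
move=> ik; rewrite nth_cat size_map size_iota ik (nth_map 0%N) ?size_iota//.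
by rewrite nth_iota.
Qed.

Lemma dyadic_blocks_bounds (c : nat -> nat) (M : nat) :
  all (fun x => 4 <= x <= 4 * 2 ^ M)%N (dyadic_blocks c M).
Proof.
elim: M => //= M IH; rewrite all_cat; apply/andP; split.
  by apply/allP => x /nseqP[-> _]; rewrite leqnn andbT leq_pmulr// expn_gt0.
apply: sub_all IH => x /andP[-> /leq_trans]; apply.
by rewrite leq_mul2l leq_exp2l ?leqnSn.
Qed.

Lemma sorted_dyadic_blocks (c : nat -> nat) (M : nat) :
  pairwise geq (dyadic_blocks c M).
Proof.
elim: M => //= M IH; rewrite pairwise_cat IH andbT; apply/andP; split.
  apply/allrelP => x y /nseqP[-> _].
  move=> /(allP (dyadic_blocks_bounds c M)) /andP[_ /leq_trans]; apply.
  by rewrite leq_mul2l leq_exp2l ?leqnSn.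
by elim: (c _) => //= j ->; rewrite all_nseq/= leqnn orbT.
Qed.

Lemma sorted_degree_list (h c : nat -> nat) (n k M : nat) :
  {homo h : i j / (i <= j)%N >-> (j <= i)%N} ->
  (forall i, (i < k)%N -> (4 * 2 ^ M <= h i)%N) ->
  sorted geq (degree_list h c n k M).
Proof.
move=> h_le hM; rewrite sorted_pairwise; last first.
  by move=> x y z; rewrite /geq /= => yx zx; exact: leq_trans zx yx.
have pow_ge4 : (4 <= 4 * 2 ^ M)%N by rewrite leq_pmulr// expn_gt0.
rewrite !pairwise_cat sorted_dyadic_blocks pairwise_map.
have -> : pairwise (relpre h geq) (iota 0 k).
  apply: (@sub_pairwise _ leq) => [i j /h_le//|].
  by rewrite -(sorted_pairwise leq_trans) iota_sorted.
rewrite /=; apply/and3P; split.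
- apply/allrelP => x y /mapP[i]; rewrite mem_iota add0n => /andP[_ ik] -> yb.
  apply: leq_trans (hM _ ik); move: yb; rewrite mem_cat => /orP[|/nseqP[-> _]//].
  by move=> /(allP (dyadic_blocks_bounds c M)) /andP[].
- apply/allrelP => x y /(allP (dyadic_blocks_bounds c M)) /andP[x4 _].
  by move=> /nseqP[-> _].
- by elim: (n - k - _)%N => //= j ->; rewrite all_nseq/= orbT.
Qed.

Lemma even_degree_list (h c : nat -> nat) (n k M : nat) :
  (forall i, ~~ odd (h i)) -> ~~ odd (sumn (degree_list h c n k M)).
Proof.
move=> h_even; rewrite /degree_list !sumn_cat !oddD.
have -> : odd (sumn [seq h i | i <- iota 0 k]) = false.
  by elim: (iota 0 k) => //= i s IH; rewrite oddD IH (negbTE (h_even i)).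
have -> : odd (sumn (dyadic_blocks c M)) = false.
  by elim: M => //= M IH; rewrite sumn_cat oddD IH sumn_nseq -mulnA oddM.
by rewrite sumn_nseq oddM.
Qed.

Lemma degree_list_ge4 (h c : nat -> nat) (n k M : nat) :
  (forall i, (i < k)%N -> (4 <= h i)%N) -> all (leq 4) (degree_list h c n k M).
Proof.
move=> h4; rewrite /degree_list !all_cat all_nseq orbT andbT; apply/andP; split.
  apply/allP => x /mapP[i]; rewrite mem_iota add0n => /andP[_ ik] ->.
  exact: h4.
by apply: sub_all (dyadic_blocks_bounds c M) => x /andP[].
Qed.

(** * Averages over a degree list *)

(** With [T k] a threshold beyond which [P k] holds, [kappa n] is the largest [k <= n] with
    [T k <= n]. It tends to infinity because each [K] competes once [n] exceeds both [K] and
    [T K]. *)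
Lemma diagonal_choice (P : nat -> nat -> Prop) :
  (forall k, \forall n \near \oo, P k n) ->
  exists kappa : nat -> nat,
    kappa n @[n --> \oo] --> \oo /\ \forall n \near \oo, P (kappa n) n.
Proof.
move=> evP; have /choice[T TP] k : exists t, forall n, (t <= n)%N -> P k n.
  by have [t _ tP] := evP k; exists t.
pose kappa n := \max_(k < n.+1 | (T k <= n)%N) k.
exists kappa; split.
  move=> A [K _ KA]; exists (maxn K (T K)) => // n /=.
  rewrite geq_max => /andP[Kn TKn]; apply: KA => /=.
  have Kn1 : (K < n.+1)%N by [].
  exact: (@leq_bigmax_cond _ (fun k : 'I_n.+1 => T k <= n)%N val (Ordinal Kn1)).
exists (T 0%N) => // n /= T0n; apply: TP.
have A0 : (0 < #|[pred k : 'I_n.+1 | (T k <= n)%N]|)%N by apply/card_gt0P; exists ord0.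
have [k Tk k_max] := eq_bigmax_cond (val : 'I_n.+1 -> nat) A0.
suff -> : kappa n = k by exact: Tk.
by rewrite -k_max /kappa; apply: eq_bigl => i; rewrite inE.
Qed.

Definition block_size (R : realType) (q : R) (n m : nat) : nat :=
  Num.truncn (n%:R * ((1 - q) * q ^+ m)).

Lemma block_size_itv (R : realType) (q : R) (n m : nat) : 0 <= q <= 1 ->
  n%:R * ((1 - q) * q ^+ m) - 1 <= (block_size R q n m)%:R <=
    n%:R * ((1 - q) * q ^+ m).
Proof.
move=> /andP[q0 q1]; set y := n%:R * _.
have y0 : 0 <= y by rewrite !mulr_ge0// ?exprn_ge0// subr_ge0.
have /andP[t1] := truncn_itv y0.
rewrite -(natr1 (Num.truncn y)) => t2.
by apply/andP; split; rewrite /block_size -/y; lra.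
Qed.

Lemma sum_geometric (R : realType) (q : R) (M : nat) :
  \sum_(1 <= m < M.+1) (1 - q) * q ^+ m = q - q ^+ M.+1.
Proof.
elim: M => [|M IH]; first by rewrite big_geq// expr1 subrr.
by rewrite big_nat_recr//= IH !exprS; ring.
Qed.

Lemma sum_block_size_le (R : realType) (q : R) (n M : nat) : 0 <= q <= 1 ->
  \sum_(1 <= m < M.+1) (block_size R q n m)%:R <= n%:R * q.
Proof.
move=> q01; apply: (@le_trans _ _ (\sum_(1 <= m < M.+1) n%:R * ((1 - q) * q ^+ m))).
  by apply: ler_sum => m _; have /andP[] := block_size_itv R q n m q01.
rewrite -mulr_sumr sum_geometric ler_wpM2l// lerBlDr lerDl.
by rewrite exprn_ge0//; case/andP: q01.
Qed.

(** Head and blocks take at most a quarter of the vertices each. *)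
Lemma block_sizes_fit (R : realType) (q : R) (n k M : nat) : 0 <= q <= 4^-1 ->
  (4 * k <= n)%N -> (k + \sum_(1 <= m < M.+1) block_size R q n m <= n)%N.
Proof.
move=> /andP[q0 q4] kn; rewrite -(ler_nat R) natrD natr_sum.
have q01 : 0 <= q <= 1 by lra.
have := sum_block_size_le R q n M q01.
have : n%:R * q <= n%:R * 4^-1 by rewrite ler_wpM2l.
move: kn; rewrite -(ler_nat R) natrM. by have := ler0n R n; move=> ? ? ? ?; lra.
Qed.

Lemma sum_square_blocks (R : realType) (M : nat) :
  \sum_(1 <= m < M.+1) ((4 * 2 ^ m)%N%:R : R) ^+ 2 <= 2 * (4 * 2 ^ M)%N%:R ^+ 2.
Proof.
elim: M => [|M IH]; first by rewrite big_geq// mulr_ge0// sqr_ge0.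
rewrite big_nat_recr//=; move: IH; rewrite !natrM !natrX (exprS _ M).
set x := (2 : R) ^+ M => IH.
have : 0 <= x ^+ 2 by rewrite sqr_ge0.
by nra.
Qed.

(** Here [X] dominates every degree. The head, the rounding of the block sizes and the vertices that
    these remove from the filler cost $O(kX^2)$ in total, hence $O(1/(k+1))$ after division by $n$.
    Cutting the power law at [M] moves mass $q^{M+1}$ to the value 4, where $F\le16$. *)
Lemma degree_list_mean_error (R : realType) (q X : R) (F : nat -> R)
    (h : nat -> nat) (n k M : nat) :
  0 <= q <= 4^-1 -> (0 < k)%N ->
  (forall x, (0 < x)%N -> 0 <= F x <= x%:R ^+ 2) ->
  (forall i, (i < k)%N -> (0 < h i)%N /\ (h i)%:R <= X) ->
  (4 * 2 ^ M)%N%:R <= X -> k%:R * k.+1%:R * X ^+ 2 <= n%:R ->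
  `|n%:R^-1 * \sum_(x <- degree_list h (block_size R q n) n k M) F x
    - \sum_(0 <= m < M.+1) (1 - q) * q ^+ m * F (4 * 2 ^ m)%N|
  <= 5 / k.+1%:R + 16 * q ^+ M.+1.
Proof.
move=> q04 k0 F2 hX MX kXn.
have [q0 q4] := andP q04; have q01 : 0 <= q <= 1 by lra.
have X4 : 4 <= X.
  by apply: le_trans MX; rewrite (ler_nat _ 4) leq_pmulr// expn_gt0.
have X0 : 0 <= X by lra.
have k1 : 1 <= k%:R :> R by rewrite (ler_nat _ 1).
have k11 : k.+1%:R = k%:R + 1 :> R by rewrite -natr1.
have X16 : 16 <= X ^+ 2 by rewrite expr2; nra.
have kX0 : 0 <= k%:R * X ^+ 2 by nra.
have kXn' : k%:R * X ^+ 2 * k.+1%:R <= n%:R by rewrite mulrAC.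
have n0 : 0 < n%:R :> R by rewrite k11 in kXn'; nra.
have kn : (4 * k <= n)%N by rewrite -(ler_nat R) natrM; rewrite k11 in kXn'; nra.
rewrite sum_degree_list; last exact: block_sizes_fit.
(* The term of exponent 0 in the limit corresponds to the filler, not to a block. *)
rewrite [X in _ - X]big_ltn// expr0 mulr1 expn0 muln1.
set A := \sum_(0 <= i < k) F (h i).
set B := \sum_(1 <= m < M.+1) _ * F _.
set B' := \sum_(1 <= m < M.+1) _ * F _.
set S := \sum_(1 <= m < M.+1) _%:R.
have [F0 F16] : 0 <= F 4%N /\ F 4%N <= 16.
  have /andP[? F4] := F2 4%N isT; split => //.
  by apply: le_trans F4 _; rewrite expr2; lra.
have A0 : 0 <= A.
  rewrite /A big_mkord; apply: sumr_ge0 => i _.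
  by have /andP[] := F2 _ (hX i (ltn_ord i)).1.
have AX : A <= k%:R * X ^+ 2.
  rewrite /A big_mkord mulr_natl -[X in _ <= _ *+ X]card_ord -sumr_const.
  apply: ler_sum => i _; have [h0 hiX] := hX i (ltn_ord i).
  have /andP[_ /le_trans] := F2 _ h0; apply.
  by rewrite ler_pXn2r ?nnegrE ?ler0n.
have FM m : 0 <= F (4 * 2 ^ m)%N <= (4 * 2 ^ m)%N%:R ^+ 2.
  by apply: F2; rewrite muln_gt0 expn_gt0.
have BB : 0 <= n%:R * B' - B <= 2 * X ^+ 2.
  have -> : n%:R * B' - B = \sum_(1 <= m < M.+1)
      (n%:R * ((1 - q) * q ^+ m) - (block_size R q n m)%:R) * F (4 * 2 ^ m)%N.
    rewrite mulr_sumr -sumrB; apply: eq_bigr => m _.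
    by rewrite [RHS]mulrBl !mulrA.
  apply/andP; split.
    apply: sumr_ge0 => m _; rewrite mulr_ge0//; last by have /andP[] := FM m.
    by rewrite subr_ge0; have /andP[] := block_size_itv R q n m q01.
  apply: (@le_trans _ _ (\sum_(1 <= m < M.+1) (4 * 2 ^ m)%N%:R ^+ 2)).
    apply: ler_sum => m _; have /andP[f0 f1] := FM m.
    apply: le_trans f1; rewrite ler_piMl//.
    by have /andP[] := block_size_itv R q n m q01; lra.
  apply: le_trans (sum_square_blocks R M) _; rewrite ler_wpM2l//.
  by rewrite ler_pXn2r ?nnegrE ?ler0n.
have SS : 0 <= n%:R * (q - q ^+ M.+1) - S <= M%:R.
  have -> : n%:R * (q - q ^+ M.+1) - S = \sum_(1 <= m < M.+1)
      (n%:R * ((1 - q) * q ^+ m) - (block_size R q n m)%:R).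
    by rewrite sumrB -mulr_sumr sum_geometric.
  apply/andP; split.
    apply: sumr_ge0 => m _.
    by rewrite subr_ge0; have /andP[] := block_size_itv R q n m q01.
  rewrite -[leRHS]mulr1 mulr_natl -[X in _ <= _ *+ X](subn1 M.+1) -sumr_const_nat.
  by apply: ler_sum => m _; have /andP[] := block_size_itv R q n m q01; lra.
(* Rounding down [M] block sizes adds at most [M] filler vertices, each weighing at most 16. *)
have MX2 : 16 * M%:R <= X ^+ 2.
  apply: (@le_trans _ _ ((4 * 2 ^ M)%N%:R ^+ 2)).
    rewrite -natrX -natrM ler_nat expnMn -expnM leq_mul2l/=.
    by rewrite (leq_trans (ltnW (ltn_expl M (isT : 1 < 2)%N)))// leq_exp2l// leq_pmulr.
  by rewrite ler_pXn2r ?nnegrE ?ler0n.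
have qM0 : 0 <= q ^+ M.+1 by rewrite exprn_ge0.
have -> : n%:R^-1 * (A + B + (n%:R - k%:R - S) * F 4%N) - ((1 - q) * F 4%N + B')
   = n%:R^-1 * (A - (n%:R * B' - B)
       + F 4%N * (n%:R * (q - q ^+ M.+1) - S + n%:R * q ^+ M.+1 - k%:R)).
  by field; rewrite gt_eqF.
rewrite normrM gtr0_norm ?invr_gt0// ler_pdivrMl// [leRHS]mulrDr.
have kn5 : 5 * (k%:R * X ^+ 2) <= n%:R * (5 / k.+1%:R).
  by rewrite [leRHS]mulrCA ler_pM2l// ler_pdivlMr ?ltr0n.
move: BB SS; set b := _ - B; set s := _ - S => /andP[b0 b1] /andP[s0 s1].
have nq0 : 0 <= n%:R * q ^+ M.+1 by rewrite mulr_ge0// ltW.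
set w := n%:R * q ^+ M.+1 in nq0 *.
have -> : n%:R * (16 * q ^+ M.+1) = 16 * w by rewrite mulrCA.
apply: le_trans (_ : 5 * (k%:R * X ^+ 2) + 16 * w <= _); last by rewrite lerD2r.
have Fs : 0 <= F 4%N * s <= X ^+ 2 by apply/andP; split; nra.
have Fw : 0 <= F 4%N * w <= 16 * w by apply/andP; split; nra.
have Fk : 0 <= F 4%N * k%:R <= k%:R * X ^+ 2 by apply/andP; split; nra.
have Xk : X ^+ 2 <= k%:R * X ^+ 2 by nra.
by rewrite ler_norml; apply/andP; split; lra.
Qed.

(** The bound $q<1/4$ makes the second moment finite: the series is dominated by a geometric one of
    ratio $4q<1$. *)
Lemma geometric_expectation (R : realType) (q : R) : 0 <= q < 4^-1 ->
  exists P : probability nat R, forall f : nat -> R,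
    (forall m, 0 <= f m <= (4 * 2 ^ m)%N%:R ^+ 2) ->
    exists2 s : R, (\int[P]_m (f m)%:E = s%:E)%E &
      \sum_(0 <= m < M) (1 - q) * q ^+ m * f m @[M --> \oo] --> s.
Proof.
move=> /andP[q0 q4].
have q1 : q < 1 by lra.
have p0 m : 0 <= (1 - q) * q ^+ m by rewrite mulr_ge0 ?exprn_ge0//; lra.
have [|P PE] := @probability_of_weights _ (fun m => (1 - q) * q ^+ m) p0.
  apply/cvg_lim => //; apply: cvg_EFin; first by apply: nearW => n; rewrite sumEFin.
  rewrite [X in X @ _ --> _](_ : _ = series (geometric (1 - q) q)); last first.
    by apply/funext => n; rewrite /comp sumEFin.
  have := @cvg_geometric_series R (1 - q) q; rewrite divff ?subr_eq0 ?gt_eqF//.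
  by apply; rewrite ger0_norm.
exists P => f f01; have f0 m : 0 <= f m by have /andP[] := f01 m.
have : cvgn (series (fun m => (1 - q) * q ^+ m * f m)).
  apply: (@series_le_cvg _ _ (geometric (16 * (1 - q)) (4 * q))) => [m|m|m|].
  - by rewrite mulr_ge0.
  - by rewrite geometric_ge0// mulr_ge0//; lra.
  - have /andP[_ fm] := f01 m; apply: le_trans (ler_wpM2l (p0 m) fm) _.
    rewrite /geometric /= natrM natrX !exprMn -exprM mulnC exprM.
    rewrite le_eqVlt; apply/orP; left; apply/eqP.
    have -> : (2 : R) ^+ 2 = 4 by rewrite -natrX.
    have -> : (4 : R) ^+ 2 = 16 by rewrite -natrX.
    ring.
  - by apply: is_cvg_geometric_series; rewrite ger0_norm; lra.
move=> /cvg_ex[s sP]; exists s; last exact: sP.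
rewrite PE//; apply/cvg_lim => //; apply: cvg_EFin.
  by apply: nearW => n; rewrite sumEFin.
by apply: cvg_trans sP; apply: near_eq_cvg; apply: nearW => n; rewrite /comp sumEFin.
Qed.

Lemma near_powR_ge (R : realType) (a B : R) : 0 < a ->
  \forall n \near \oo, B <= n%:R `^ a.
Proof.
move=> a0; near=> n.
have B0 : 0 <= Num.max B 0 by rewrite le_max lexx orbT.
apply: (@le_trans _ _ (Num.max B 0)); first by rewrite le_max lexx.
have -> : Num.max B 0 = (Num.max B 0 `^ a^-1) `^ a.
  by rewrite -powRrM mulVf ?gt_eqF// powRr1.
rewrite ge0_ler_powR ?nnegrE ?powR_ge0 ?ler0n ?(ltW a0)//.
by near: n; exact: nbhs_infty_ger.
Unshelve. all: by end_near. Qed.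

(** * Interpolating between theta and the dyadic power law *)

Definition vertex_scale (R : realType) (tau : R) (n : nat) : R :=
  n%:R `^ alpha tau.

(* The fourth condition expresses that k grows slowly enough: it makes the     *)
(* contribution of the first k vertices to the second moment at most 1/(k+1).  *)
Definition interpolates (R : realType) (tau : R) (theta : nat -> R)
    (n k M : nat) (d : seq nat) : Prop :=
  let N := vertex_scale R tau n in
  [/\ (0 < k <= M)%N, theta k < theta 0%N,
      (4 * 2 ^ M)%N%:R <= N * theta k < (8 * 2 ^ M)%N%:R,
      k%:R * k.+1%:R * (N * theta 0%N + 2) ^+ 2 <= n%:R &
      d = degree_list (fun i => even_above R (N * theta i))
            (block_size R (2 `^ (1 - tau)) n) n k M].

Lemma dyadic_scale (R : realType) (y : R) : 4 <= y ->
  exists M, (4 * 2 ^ M)%N%:R <= y < (8 * 2 ^ M)%N%:R.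
Proof.
move=> y4; set t := Num.truncn (y / 4).
have y0 : 0 <= y / 4 by lra.
have /andP[t1 t2] := truncn_itv y0.
have t0 : (0 < t)%N by rewrite truncn_gt0; lra.
have /andP[M1 M2] := trunc_log_bounds (isT : (1 < 2)%N) t0.
exists (trunc_log 2 t); move: M1 M2; rewrite -(ler_nat R) -[(_ < _)%N](ler_nat R).
rewrite expnS !natrM => M1 M2; rewrite -/t in t1 t2; apply/andP; split; lra.
Qed.

(** With $q=2^{1-\tau}$, the inequality $4q<1$ expresses a finite second moment. The inequality
    $8q>1$ makes the sums of cubes over the blocks grow geometrically, so that the last block
    dominates. *)
Lemma exponent_bounds (R : realType) (tau : R) : 3 < tau < 4 ->
  0 < (2 : R) `^ (1 - tau) < 4^-1 /\ 1 < 8 * (2 : R) `^ (1 - tau).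
Proof.
move=> /andP[t3 t4].
have E (n : nat) : (2 : R) `^ (- n%:R) = 2 ^- n by rewrite powR_invn//; lra.
have mono x y : x < y -> (2 : R) `^ x < 2 `^ y.
  by move=> xy; rewrite /powR pnatr_eq0/= ltr_expR ltr_pM2r// ln_gt0//; lra.
have := mono (1 - tau) (- 2%:R) ltac:(lra).
have := mono (- 3%:R) (1 - tau) ltac:(lra).
have := @powR_gt0 R 2 (1 - tau) ltac:(lra).
rewrite !E; set q := 2 `^ _ => q0 q1 q2.
have E2 : (2 : R) ^- 2 = 4^-1 by congr (_^-1); rewrite -natrX.
have E3 : (2 : R) ^- 3 = 8^-1 by congr (_^-1); rewrite -natrX.
by rewrite E2 in q2; rewrite E3 in q1; split; lra.
Qed.

Lemma interpolates_bounds (R : realType) (tau : R) (theta : nat -> R)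
    (n k M : nat) (d : seq nat) :
  (forall i, 0 < theta i) -> nonincreasing_seq theta ->
  interpolates R tau theta n k M d ->
  [/\ (4 * k <= n)%N, 0 < vertex_scale R tau n,
      forall i, (i < k)%N -> (4 * 2 ^ M)%N%:R <= vertex_scale R tau n * theta i,
      forall i, (even_above R (vertex_scale R tau n * theta i))%:R
        <= vertex_scale R tau n * theta 0%N + 2 &
      (4 * 2 ^ M)%N%:R <= vertex_scale R tau n * theta 0%N + 2].
Proof.
move=> th0 th_le [/andP[k0 kM] _ /andP[MN _] kn _].
set N := vertex_scale R tau n in MN kn *.
have N0 : 0 <= N by exact: powR_ge0.
have th i j : (i <= j)%N -> N * theta j <= N * theta i.
  by move=> ij; rewrite ler_wpM2l//; exact: th_le.
have N4 : 4 <= N * theta k.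
  by apply: le_trans MN; rewrite (ler_nat R 4) leq_pmulr// expn_gt0.
have Nt := th _ _ (leq0n k).
split.
- rewrite -(ler_nat R) natrM; apply: le_trans kn.
  rewrite mulrC -mulrA ler_wpM2l//.
  have : 1 <= k.+1%:R :> R by rewrite (ler_nat R 1).
  set X := _ + 2; have X6 : 6 <= X by rewrite /X; lra.
  by move=> k1; have : 4 <= X ^+ 2; [rewrite expr2; nra|nra].
- by rewrite lt_neqAle N0 andbT; apply/eqP => N00; rewrite -N00 mul0r in N4; lra.
- by move=> i ik; apply: le_trans MN _; exact/th/ltnW.
- move=> i; have /even_above_itv/andP[_ /le_trans] : 0 <= N * theta i.
    by rewrite mulr_ge0// ltW.
  by apply; rewrite lerD2r th.
- by apply: le_trans MN _; lra.
Qed.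

(** A default value for the [n] too small to carry the construction. *)
Lemma degree_sequence_nseq2 (n : nat) : degree_sequence (nseq_tuple n 2%N).
Proof.
split; last by rewrite /= sumn_nseq oddM.
rewrite sorted_pairwise; last by move=> x y z; rewrite /geq /= => yx /leq_trans; apply.
by rewrite /=; elim: n => //= n ->; rewrite all_nseq orbT.
Qed.

Lemma degree_sequence_interpolates (R : realType) (tau : R) (theta : nat -> R)
    (n k M : nat) (d : seq nat) :
  3 < tau < 4 -> (forall i, 0 < theta i) -> nonincreasing_seq theta ->
  interpolates R tau theta n k M d ->
  exists2 dn : n.-tuple nat, tval dn = d & degree_sequence dn.
Proof.
move=> tau34 th0 th_le I.
have [kn N0 NM _ _] := interpolates_bounds _ _ _ _ _ _ _ th0 th_le I.
have [_ _ _ _ dE] := I; have [q04 _] := exponent_bounds _ _ tau34.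
have size_d : size d == n.
  by rewrite dE size_degree_list//; apply: block_sizes_fit kn; lra.
exists (Tuple size_d) => //; split; rewrite /= dE.
  apply: sorted_degree_list => [i j ij|i ik].
    by apply: even_above_le; rewrite ler_wpM2l ?(ltW N0)//; exact: th_le.
  rewrite -(ler_nat R); apply: le_trans (NM _ ik) _.
  have /even_above_itv/andP[/ltW//] : 0 <= vertex_scale R tau n * theta i.
  by rewrite mulr_ge0// ltW.
by apply: even_degree_list => i; rewrite /even_above oddM.
Qed.

(** For fixed [k] the requirements hold for all large [n], since $N\to\infty$ and
    $n/N^2=N^{\tau-3}\to\infty$. A diagonal choice then lets [k] grow with [n]. *)
Lemma exists_interpolation (R : realType) (tau : R) (theta : nat -> R) :
  3 < tau < 4 -> (forall i, 0 < theta i) -> nonincreasing_seq theta ->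
  theta n @[n --> \oo] --> (0 : R) ->
  exists (d : forall n, n.-tuple nat) (kappa M : nat -> nat),
    [/\ forall n, degree_sequence (d n),
        kappa n @[n --> \oo] --> \oo &
        \forall n \near \oo, interpolates R tau theta n (kappa n) (M n) (d n)].
Proof.
move=> tau34 th0 th_le th_cvg.
pose P k n := (4 * 2 ^ k)%N%:R <= vertex_scale R tau n * theta k /\
  k%:R * k.+1%:R * (vertex_scale R tau n * theta 0%N + 2) ^+ 2 <= n%:R.
have a0 : 0 < alpha tau by rewrite /alpha invr_gt0; lra.
have a3 : 0 < alpha tau * (tau - 3) by rewrite mulr_gt0//; lra.
have nE n : vertex_scale R tau n `^ (tau - 1) = n%:R.
  by rewrite -powRrM mulVf ?powRr1//; lra.
have [|kappa [kappa_oo kappaP]] := @diagonal_choice P.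
  move=> k; near=> n.
  have N1 : 1 <= vertex_scale R tau n by near: n; exact: near_powR_ge.
  have Nk : (4 * 2 ^ k)%N%:R / theta k <= vertex_scale R tau n.
    by near: n; exact: near_powR_ge.
  have N3 : k%:R * k.+1%:R * (theta 0%N + 2) ^+ 2
      <= vertex_scale R tau n `^ (tau - 3).
    by rewrite -powRrM; near: n; exact: near_powR_ge.
  rewrite /P -(nE n); set N := vertex_scale R tau n in N1 Nk N3 *.
  split; first by rewrite -ler_pdivrMr.
  have -> : N `^ (tau - 1) = N `^ (tau - 3) * N ^+ 2.
    rewrite -powR_mulrn ?ltW// -?powRD; last by apply/implyP; lra.
      by congr (_ `^ _); lra.
    lra.
  apply: le_trans (ler_wpM2r (sqr_ge0 N) N3).
  rewrite -[leRHS]mulrA ler_wpM2l ?mulr_ge0//.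
  rewrite -exprMn ler_pXn2r ?nnegrE//; [|by have := th0 0%N; nra..].
  lra.
have nearI : \forall n \near \oo, exists M d,
    interpolates R tau theta n (kappa n) M d.
  near=> n.
  have [kN kn] : P (kappa n) n by near: n.
  have k0 : (0 < kappa n)%N.
    by near: n; apply: (kappa_oo (fun k => (0 < k)%N)); exact: nbhs_infty_gt.
  have kt : theta (kappa n) < theta 0%N.
    near: n; apply: (kappa_oo (fun k => theta k < theta 0%N)).
    by have /cvgr_lt := th_cvg; exact.
  have [|M NM] := @dyadic_scale R (vertex_scale R tau n * theta (kappa n)).
    by apply: le_trans kN; rewrite (ler_nat R 4) leq_pmulr// expn_gt0.
  exists M; eexists; split => //; rewrite k0/=.
  (* From $4\cdot2^k\le N\theta_k<8\cdot2^M$ it follows that $k\le M$; thus the cutoff [M] tends to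
     infinity along with [k]. *)
  rewrite -ltnS -(ltn_exp2l _ _ (isT : 1 < 2)%N).
  have /andP[_] := NM; move/(le_lt_trans kN); rewrite ltr_nat.
  by rewrite expnS; lia.
(* The conditional form gives a statement valid for every [n], from which a sequence can be
   chosen. *)
have H n : exists dM : n.-tuple nat * nat,
    degree_sequence dM.1 /\
    ((exists M d, interpolates R tau theta n (kappa n) M d) ->
      interpolates R tau theta n (kappa n) dM.2 dM.1).
  have [[M [d I]]|nI] := pselect (exists M d, interpolates R tau theta n (kappa n) M d).
    have [dn dE dnP] := degree_sequence_interpolates _ _ _ _ _ _ _ tau34 th0 th_le I.
    by exists (dn, M); split => //=; rewrite dE.
  exists (nseq_tuple n 2%N, 0%N); split => //; exact: degree_sequence_nseq2.
exists (fun n => (sval (cid (H n))).1), kappa, (fun n => (sval (cid (H n))).2).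
split => //.
- by move=> n; have [] := svalP (cid (H n)).
- by near=> n; have [_ I] := svalP (cid (H n)); apply: I; near: n.
Unshelve. all: by end_near. Qed.

(** The error of [degree_list_mean_error] is $5/(k+1)+16q^{M+1}$, and both [k] and [M] tend to
    infinity. *)
Lemma interpolates_mean_cvg (R : realType) (tau : R) (theta : nat -> R)
    (d : forall n, n.-tuple nat) (kappa M : nat -> nat) (F : nat -> R) (s : R) :
  3 < tau < 4 -> (forall i, 0 < theta i) -> nonincreasing_seq theta ->
  kappa n @[n --> \oo] --> \oo ->
  (\forall n \near \oo, interpolates R tau theta n (kappa n) (M n) (d n)) ->
  (forall x, (0 < x)%N -> 0 <= F x <= x%:R ^+ 2) ->
  (let q := (2 : R) `^ (1 - tau) in
   \sum_(0 <= m < K) (1 - q) * q ^+ m * F (4 * 2 ^ m)%N @[K --> \oo] --> s) ->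
  n%:R^-1 * \sum_(x <- d n) F x @[n --> \oo] --> s.
Proof.
move=> tau34 th0 th_le kappa_oo nearI F2 /=; set q := 2 `^ _ => Fs.
have [q04 _] := exponent_bounds _ _ tau34; rewrite -/q in q04.
set G := fun K => \sum_(0 <= m < K) _ in Fs.
have M_oo : (M n).+1 @[n --> \oo] --> \oo.
  move=> A [K _ KA]; suff : \forall n \near \oo, A (M n).+1 by [].
  near=> n; apply: KA; apply: leqW.
  have [/andP[_ kM] _ _ _ _] :
    interpolates R tau theta n (kappa n) (M n) (d n) by near: n.
  apply: leq_trans kM; near: n; apply: (kappa_oo (fun k => (K <= k)%N)).
  exact: nbhs_infty_ge.
have GM : G (M n).+1 @[n --> \oo] --> s by exact: cvg_comp M_oo Fs.
suff E0 : n%:R^-1 * (\sum_(x <- d n) F x) - G (M n).+1 @[n --> \oo] --> (0 : R).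
  rewrite -[s]add0r; apply: cvg_trans (cvgD E0 GM); apply: near_eq_cvg.
  by apply: nearW => n /=; rewrite subrK.
apply: norm_cvg0.
apply: (@squeeze_cvgr _ _ _ _ (cst 0)
  (fun n => 5 / (kappa n).+1%:R + 16 * q ^+ (M n).+1)).
- near=> n; rewrite normr_ge0/=.
  have I : interpolates R tau theta n (kappa n) (M n) (d n) by near: n.
  have [kn N0 NM hX MX] := interpolates_bounds _ _ _ _ _ _ _ th0 th_le I.
  have [/andP[k0 _] _ _ kXn ->] := I.
  apply: degree_list_mean_error kXn => //.
  by rewrite -/q; lra.
- exact: cvg_cst.
- rewrite -[X in _ --> X]addr0 -[X in _ --> X + _](mulr0 5).
  rewrite -[X in _ --> _ + X](mulr0 16).
  apply: cvgD; apply: cvgMr.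
    exact: cvg_comp kappa_oo (@cvg_harmonic R).
  apply: cvg_comp M_oo _; apply: cvg_expr; rewrite ger0_norm; lra.
Unshelve. all: by end_near. Qed.

Lemma vertex_scaleV_cvg0 (R : realType) (tau : R) : 1 < tau ->
  (vertex_scale R tau n)^-1 @[n --> \oo] --> (0 : R).
Proof.
move=> tau1; apply/cvgr0Pnorm_le => e e0; near=> n.
have N0 : e^-1 <= vertex_scale R tau n.
  by near: n; apply: near_powR_ge; rewrite /alpha invr_gt0 subr_gt0.
rewrite ger0_norm ?invr_ge0 ?powR_ge0// -[leRHS]invrK lef_pV2// posrE ?invr_gt0//.
by apply: lt_le_trans N0; rewrite invr_gt0.
Unshelve. all: by end_near. Qed.

(** A fixed vertex eventually lies in the head, where the rounding error of at most 2 disappears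
    after division by $N$. *)
Lemma assumption1_i_interpolates (R : realType) (tau : R) (theta : nat -> R)
    (d : forall n, n.-tuple nat) (kappa M : nat -> nat) :
  1 < tau -> (forall i, 0 < theta i) -> nonincreasing_seq theta ->
  kappa n @[n --> \oo] --> \oo ->
  (\forall n \near \oo, interpolates R tau theta n (kappa n) (M n) (d n)) ->
  assumption1_i tau theta d.
Proof.
move=> tau1 th0 th_le kappa_oo nearI i.
apply: (@squeeze_cvgr _ _ _ _ (cst (theta i))
  (fun n => theta i + 2 * (vertex_scale R tau n)^-1)).
- near=> n.
  have I : interpolates R tau theta n (kappa n) (M n) (d n) by near: n.
  have [_ N0 _ _ _] := interpolates_bounds _ _ _ _ _ _ _ th0 th_le I.
  have ik : (i < kappa n)%N.
    by near: n; apply: (kappa_oo (fun k => (i < k)%N)); exact: nbhs_infty_gt.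
  have [_ _ _ _ dE] := I.
  rewrite powRN -/(vertex_scale R tau n) /deg dE nth_degree_list//=.
  have /even_above_itv/andP[h1 h2] : 0 <= vertex_scale R tau n * theta i.
    by rewrite mulr_ge0// ltW.
  by rewrite ler_pdivlMl// (ltW h1) ler_pdivrMl// mulrDr mulrCA divff ?gt_eqF// mulr1.
- exact: cvg_cst.
- rewrite -[X in _ --> X]addr0 -[X in _ --> _ + X](mulr0 2).
  apply: cvgD; first exact: cvg_cst.
  by apply: cvgMr; exact: vertex_scaleV_cvg0.
Unshelve. all: by end_near. Qed.

Lemma sum_nth_tuple (R : realType) (n : nat) (d : n.-tuple nat) (F : nat -> R) :
  \sum_(i < n) F (nth 0%N d i) = \sum_(x <- d) F x.
Proof. by rewrite (big_nth 0%N) size_tuple big_mkord. Qed.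

Lemma expectation_uniform_degree (R : realType) (n : nat) (d : n.-tuple nat)
    (F : nat -> R) : (0 < n)%N -> (forall x, 0 <= F x) ->
  'E_(uniform_vertex R n)[(fun i => F (nth 0%N d i))]%E
    = (n%:R^-1 * \sum_(x <- d) F x)%:E.
Proof. by move=> n0 F0; rewrite expectation_uniform_vertex// sum_nth_tuple. Qed.

Definition dyadic_degree (R : realType) (m : nat) : R := (4 * 2 ^ m)%N%:R.

HB.instance Definition _ (R : realType) :=
  isMeasurableFun.Build _ _ nat R (dyadic_degree R) (fun _ _ _ => I).

Lemma countable_range_dyadic_degree (R : realType) :
  countable (range (dyadic_degree R)).
Proof. exact: card_image_le. Qed.

HB.instance Definition _ (R : realType) :=
  MeasurableFun_isDiscrete.Build _ _ nat R (dyadic_degree R)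
    (countable_range_dyadic_degree R).

Lemma cdf_nat (R : realType) (P : probability nat R) (X : {RV P >-> R}) (x : R) :
  cdf X x = 'E_P[(fun i => (X i <= x)%R%:R)]%E.
Proof.
rewrite /cdf /distribution /pushforward probability_integral_indic unlock.
apply: eq_integral => i _; congr (_%:E); rewrite indicE; congr (nat_of_bool _)%:R.
by apply/idP/idP; rewrite inE/= in_itv/=.
Qed.

(** One mean convergence serves three times: for the identity, the square, and the indicator of
    $y\le x$, whose mean is the distribution function. All three are at most $y^2$ at positive
    integers $y$. *)
Lemma interpolates_moments (R : realType) (tau : R) (theta : nat -> R)
    (d : forall n, n.-tuple nat) (kappa M : nat -> nat) :
  3 < tau < 4 -> (forall i, 0 < theta i) -> nonincreasing_seq theta ->
  kappa n @[n --> \oo] --> \oo ->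
  (\forall n \near \oo, interpolates R tau theta n (kappa n) (M n) (d n)) ->
  exists (P : probability nat R) (mu mu2 : R),
    [/\ cvg_in_distribution (Pn := uniform_vertex R) (fun n => deg R (d n))
          (dyadic_degree R : {RV P >-> R}),
        ('E_P[dyadic_degree R] = mu%:E)%E,
        ('E_P[(fun m => dyadic_degree R m ^+ 2)%R] = mu2%:E)%E,
        n%:R^-1 * \sum_(x <- d n) x%:R @[n --> \oo] --> mu &
        n%:R^-1 * \sum_(x <- d n) x%:R ^+ 2 @[n --> \oo] --> mu2].
Proof.
move=> tau34 th0 th_le kappa_oo nearI.
have [q04 _] := exponent_bounds _ _ tau34.
have [|P PE] := @geometric_expectation R (2 `^ (1 - tau)); first by lra.
have mean F : (forall x, (0 < x)%N -> 0 <= F x <= x%:R ^+ 2) ->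
    exists2 s, ('E_P[(fun m => F (4 * 2 ^ m)%N)] = s%:E)%E &
      n%:R^-1 * \sum_(x <- d n) F x @[n --> \oo] --> s.
  move=> F2; have [|s sE scvg] := PE (fun m => F (4 * 2 ^ m)%N).
    by move=> m; apply: F2; rewrite muln_gt0 expn_gt0.
  exists s; first by rewrite unlock.
  exact: interpolates_mean_cvg tau34 th0 th_le kappa_oo nearI F2 scvg.
have [|mu muE mu_cvg] := mean (fun x => x%:R).
  by move=> x x0; rewrite ler0n -natrX ler_nat leq_pmulr.
have [|mu2 mu2E mu2_cvg] := mean (fun x => x%:R ^+ 2).
  by move=> x x0; rewrite sqr_ge0/=.
exists P, mu, mu2; split => // x _.
have [|s sE s_cvg] := mean (fun y => (y%:R <= x)%R%:R).
  move=> y y0; rewrite ler0n/= -natrX ler_nat (leq_trans (leq_b1 _))//.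
  by rewrite expn_gt0 y0.
rewrite cdf_nat [X in _ --> X]sE.
apply: cvg_trans
  (_ : (n%:R^-1 * \sum_(y <- d n) (y%:R <= x)%R%:R)%:E @[n --> \oo] --> s%:E).
  apply: near_eq_cvg; near=> n.
  have n0 : (0 < n)%N by near: n; exact: nbhs_infty_gt.
  rewrite cdf_nat.
  by rewrite (@expectation_uniform_degree R n (d n) (fun y => (y%:R <= x)%R%:R)).
by apply: cvg_EFin => //; apply: nearW.
Unshelve. all: by end_near. Qed.

(** * Third moment *)

Lemma sum_powers_le (R : realType) (r : R) (M : nat) : 1 < r ->
  \sum_(1 <= m < M.+1) r ^+ m <= r ^+ M * (r / (r - 1)).
Proof.
move=> r1; have r0 : 0 < r - 1 by rewrite subr_gt0.
elim: M => [|M IH].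
  by rewrite big_geq// expr0 mul1r divr_ge0// ?ltW//; lra.
rewrite big_nat_recr//=; apply: le_trans (lerD IH (lexx _)) _.
rewrite le_eqVlt; apply/orP; left; apply/eqP; rewrite exprS; field.
by rewrite gt_eqF.
Qed.

(** Head degrees are at most $2N\theta_i$, whence the factor 8. Block [m] contributes at most
    $64nr^m$, and as $r>1$ these terms sum to a multiple of $nr^M$. *)
Lemma interpolates_third_moment (R : realType) (tau : R) (theta : nat -> R)
    (n k M K : nat) (d : n.-tuple nat) :
  3 < tau < 4 -> (forall i, 0 < theta i) -> nonincreasing_seq theta ->
  (K <= k)%N -> interpolates R tau theta n k M d ->
  forall r : R, r = 8 * 2 `^ (1 - tau) ->
  n%:R `^ (- (3 * alpha tau)) * \sum_(K <= i < n) deg R d i ^+ 3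
    <= 8 * \sum_(K <= i < k) theta i ^+ 3
       + 64 * (1 + r / (r - 1)) * theta k `^ (4 - tau).
Proof.
move=> tau34 th0 th_le Kk I r rE.
have [kn N0 NM _ _] := interpolates_bounds _ _ _ _ _ _ _ th0 th_le I.
have [/andP[k0 kM] _ /andP[MN NM8] _ dE] := I.
have [q04 r1] := exponent_bounds _ _ tau34; rewrite -rE in r1.
set q := 2 `^ (1 - tau) in q04 rE dE.
set N := vertex_scale R tau n in N0 NM MN NM8 dE.
have -> : n%:R `^ (- (3 * alpha tau)) = (N ^+ 3)^-1.
  by rewrite powRN mulrC powRrM powR_mulrn// powR_ge0.
rewrite ler_pdivrMl ?exprn_gt0//.
have Nt_ge4 i : (i < k)%N -> 4 <= N * theta i.
  by move=> ik; apply: le_trans (NM _ ik); rewrite (ler_nat R 4) leq_pmulr// expn_gt0.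
set h := fun i => even_above R (N * theta i) in dE.
have fit : (k + \sum_(1 <= m < M.+1) block_size R q n m <= n)%N.
  by apply: block_sizes_fit kn; lra.
have -> : \sum_(K <= i < n) deg R d i ^+ 3
    = \sum_(K <= i < k) (h i)%:R ^+ 3
      + \sum_(1 <= m < M.+1) (block_size R q n m)%:R * (4 * 2 ^ m)%N%:R ^+ 3
      + (n%:R - k%:R - \sum_(1 <= m < M.+1) (block_size R q n m)%:R) * 4 ^+ 3.
  have T := sum_degree_list R h (block_size R q n) n k M (fun x => x%:R ^+ 3) fit.
  rewrite -dE (big_nth 0%N) size_tuple in T.
  rewrite (big_cat_nat (leq0n K)) in T; last by lia.
  rewrite (big_cat_nat (leq0n K) Kk)/= in T.
  have E : \sum_(0 <= i < K) (nth 0%N d i)%:R ^+ 3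
      = \sum_(0 <= i < K) (h i)%:R ^+ 3 :> R.
    apply: eq_big_nat => i /andP[_ iK]; rewrite dE nth_degree_list//.
    exact: leq_trans iK Kk.
  by rewrite E -!addrA in T; move/addrI: T => ->; rewrite !addrA.
have n0 : 0 <= n%:R :> R by [].
have head_le : \sum_(K <= i < k) (h i)%:R ^+ 3
    <= N ^+ 3 * (8 * \sum_(K <= i < k) theta i ^+ 3).
  rewrite mulrCA mulr_sumr mulr_sumr; apply: ler_sum_nat => i /andP[_ ik].
  have N4 := Nt_ge4 _ ik.
  have /even_above_itv/andP[_ h2] : 0 <= N * theta i by lra.
  apply: (@le_trans _ _ ((2 * (N * theta i)) ^+ 3)); last by rewrite !exprMn -natrX.
  by rewrite ler_pXn2r ?nnegrE ?ler0n//; [lra|rewrite -/(h i) in h2; lra].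
have q01 : 0 <= q <= 1 by lra.
have block_le : \sum_(1 <= m < M.+1) (block_size R q n m)%:R * (4 * 2 ^ m)%N%:R ^+ 3
    <= 64 * (n%:R * (r ^+ M * (r / (r - 1)))).
  apply: (@le_trans _ _ (64 * (n%:R * \sum_(1 <= m < M.+1) r ^+ m))); last first.
    by rewrite ler_wpM2l// ler_wpM2l//; exact: sum_powers_le.
  rewrite mulr_sumr mulr_sumr; apply: ler_sum => m _.
  have /andP[_ b2] := block_size_itv R q n m q01.
  have -> : 64 * (n%:R * r ^+ m) = n%:R * q ^+ m * (4 * 2 ^ m)%N%:R ^+ 3 :> R.
    rewrite natrM natrX rE !exprMn -exprM mulnC exprM.
    have -> : (2 : R) ^+ 3 = 8 by rewrite -natrX.
    have -> : (4 : R) ^+ 3 = 64 by rewrite -natrX.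
    ring.
  rewrite ler_wpM2r ?exprn_ge0//; apply: le_trans b2 _.
  by rewrite ler_wpM2l// ler_piMl ?exprn_ge0//; lra.
have S0 : 0 <= \sum_(1 <= m < M.+1) (block_size R q n m)%:R :> R by exact: sumr_ge0.
have rM1 : 1 <= r ^+ M by rewrite exprn_ege1// ltW.
(* Since $r=2^{4-\tau}$ and $2^M\le N\theta_k$, one gets $nr^M\le
   N^{\tau-1}(N\theta_k)^{4-\tau}$. *)
have nrM : n%:R * r ^+ M <= N ^+ 3 * theta k `^ (4 - tau).
  have -> : r ^+ M = (2 ^+ M) `^ (4 - tau).
    rewrite -powR_mulrn; last lra.
    rewrite rE /q -[8]/(8%:R) (_ : 8%:R = 2 `^ 3%:R :> R); last first.
      by rewrite powR_mulrn// -natrX.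
    rewrite -powRD; last by apply/implyP => _; lra.
    rewrite -powRrM -powR_mulrn// -powRrM; congr (_ `^ _); lra.
  have -> : n%:R = N `^ (tau - 1) :> R by rewrite -powRrM mulVf ?powRr1//; lra.
  have -> : N ^+ 3 = N `^ (tau - 1) * N `^ (4 - tau).
    rewrite -powRD; last by apply/implyP => _; rewrite gt_eqF.
    by rewrite -powR_mulrn ?ltW//; congr (_ `^ _); lra.
  rewrite -mulrA ler_wpM2l ?powR_ge0//.
  rewrite -powRM ?(ltW N0) ?(ltW (th0 k))//.
  rewrite ge0_ler_powR ?nnegrE ?exprn_ge0 ?mulr_ge0 ?(ltW N0) ?(ltW (th0 k))//.
    by lra.
  by apply: le_trans MN; rewrite -natrX ler_nat leq_pmull.
have rr0 : 0 <= r / (r - 1) by rewrite divr_ge0//; lra.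
set W := n%:R * r ^+ M in nrM.
(* This absorbs the filler, whose cubes sum to at most $64n$. *)
have nW : n%:R <= W by rewrite /W ler_peMr.
have -> : (4 : R) ^+ 3 = 64 by rewrite -natrX.
rewrite [leRHS]mulrDr -addrA; apply: lerD head_le _.
rewrite [n%:R * (_ * _)]mulrA -/W in block_le.
have -> : N ^+ 3 * (64 * (1 + r / (r - 1)) * theta k `^ (4 - tau))
  = 64 * (N ^+ 3 * theta k `^ (4 - tau)) * (1 + r / (r - 1)) by ring.
apply: (@le_trans _ _ (64 * W * (1 + r / (r - 1)))); last first.
  by rewrite ler_wpM2r ?addr_ge0// ler_wpM2l.
have : 0 <= k%:R :> R by [].
set s := \sum_(1 <= m < M.+1) (block_size R q n m)%:R in S0 *.
set B := \sum_(1 <= m < M.+1) _ in block_le *; set a := r / (r - 1) in block_le *.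
by move=> kR; rewrite mulrDr mulr1; lra.
Qed.

Lemma cvg_powR_0 (R : realType) (a : R) (u : nat -> R) : 0 < a ->
  (forall n, 0 <= u n) -> u n @[n --> \oo] --> (0 : R) ->
  u n `^ a @[n --> \oo] --> (0 : R).
Proof.
move=> a0 u0 u_cvg; apply/cvgr0Pnorm_le => e e0; near=> n.
rewrite ger0_norm ?powR_ge0// -[leRHS]powRr1 ?(ltW e0)// -(mulVf (lt0r_neq0 a0)) powRrM.
rewrite ge0_ler_powR ?nnegrE ?powR_ge0 ?(ltW a0)//.
near: n; have /cvgr0Pnorm_le /(_ (e `^ a^-1)) := u_cvg.
move=> /(_ (powR_gt0 _ e0)); apply: filterS => n.
by rewrite ger0_norm.
Unshelve. all: by end_near. Qed.

Lemma limn_esup_le_near (R : realType) (u : nat -> \bar R) (b : \bar R) :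
  (\forall n \near \oo, u n <= b)%E -> (limn_esup u <= b)%E.
Proof.
move=> ub; apply: le_trans (_ : ereal_sup (u @` [set n | (u n <= b)%E]) <= b)%E.
  by apply: ereal_inf_lbound; exists [set n | (u n <= b)%E].
by apply: ge_ereal_sup => _ [n /= unb <-].
Qed.

(** For fixed [K] the block term vanishes with $\theta_{k_n}$, so the upper limit is at most 8 times
    the tail of $\sum_i\theta_i^3$ from [K]. *)
Lemma third_moment_tail (R : realType) (tau : R) (theta : nat -> R)
    (d : forall n, n.-tuple nat) (kappa M : nat -> nat) :
  3 < tau < 4 -> (forall i, 0 < theta i) -> nonincreasing_seq theta ->
  theta n @[n --> \oo] --> (0 : R) ->
  (\sum_(0 <= i <oo) (theta i ^+ 3)%:E < +oo)%E ->
  kappa n @[n --> \oo] --> \oo ->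
  (\forall n \near \oo, interpolates R tau theta n (kappa n) (M n) (d n)) ->
  limn_esup (fun n : nat =>
    (n%:R `^ (- (3 * alpha tau)) * \sum_(K <= i < n) deg R (d n) i ^+ 3)%:E)
    @[K --> \oo] --> (0%E : \bar R).
Proof.
move=> tau34 th0 th_le th_cvg th3 kappa_oo nearI.
have th30 i : (0 <= (theta i ^+ 3)%:E)%E by rewrite lee_fin exprn_ge0// ltW.
pose tail K := (\sum_(K <= i <oo) (theta i ^+ 3)%:E)%E.
apply: (@squeeze_cvge _ _ _ _ (cst 0%E) _ (fun K => 8%:E * tail K)%E).
- apply: nearW => K; apply/andP; split.
    apply: limf_esup_ge0; first by case=> N _ /(_ N (leqnn N)).
    move=> n; rewrite lee_fin mulr_ge0 ?powR_ge0// sumr_ge0// => i _.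
    by rewrite exprn_ge0.
  apply/lee_addgt0Pr => e e0; apply: limn_esup_le_near.
  set r := 8 * (2 : R) `^ (1 - tau); set C := 64 * (1 + r / (r - 1)).
  have C0 : C * theta (kappa n) `^ (4 - tau) @[n --> \oo] --> (0 : R).
    rewrite -[X in _ --> X](mulr0 C); apply: cvgMr.
    apply: cvg_powR_0; [lra|by move=> n; rewrite ltW|exact: cvg_comp kappa_oo th_cvg].
  near=> n.
  have I : interpolates R tau theta n (kappa n) (M n) (d n) by near: n.
  have Kk : (K <= kappa n)%N.
    by near: n; apply: (kappa_oo (fun k => (K <= k)%N)); exact: nbhs_infty_ge.
  have Ce : C * theta (kappa n) `^ (4 - tau) <= e.
    near: n; have /cvgr0Pnorm_le /(_ _ e0) := C0; apply: filterS => n.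
    exact: le_trans (ler_norm _).
  apply: (@le_trans _ _ (8 * \sum_(K <= i < kappa n) theta i ^+ 3 + e)%:E).
    rewrite lee_fin; apply: le_trans (interpolates_third_moment
      _ _ _ _ _ _ _ _ tau34 th0 th_le Kk I _ erefl) _.
    by rewrite -/r -/C lerD2l.
  rewrite EFinD leeD2r// EFinM lee_pmul2l// -sumEFin.
  exact: nneseries_lim_ge.
- exact: cvg_cst.
- rewrite -[X in _ --> X](mule0 8%:E); apply: cvgeZl => //.
  exact: nneseries_tail_cvg.
Unshelve. all: by end_near. Qed.

(** * Size-biased mass *)

Lemma size_biased_vertexE (R : realType) (n : nat) (d : n.-tuple nat) (l c : R) :
  (0 < sumn d)%N ->
  size_biased_vertex R d [set v | (l < deg R d v <= c * l)%R]
    = ((\sum_(x <- d) x%:R * (l < x%:R <= c * l)%R%:R) / (\sum_(x <- d) x%:R))%:E.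
Proof.
move=> d0; have sumE : (\sum_(i < n) nth 0%N d i = sumn d)%N.
  by rewrite sumnE (big_nth 0%N) size_tuple big_mkord.
rewrite probability_integral_indic integral_weighted_index ?sumE//.
congr (_ / _)%:E.
  rewrite -(@sum_nth_tuple R n d (fun x => x%:R * (l < x%:R <= c * l)%R%:R)).
  apply: eq_bigr => i _; congr (_ * _); rewrite indicE; congr (nat_of_bool _)%:R.
  by apply/idP/idP; rewrite inE.
by rewrite sumnE natr_sum.
Qed.

(** For $i\ge k$ monotonicity gives $\theta_i\le x$, so these indicators vanish. *)
Lemma truncate_power_law (R : realType) (tau b0 b1 x : R) (theta : nat -> R)
    (k : nat) :
  (forall i, 0 <= theta i) -> nonincreasing_seq theta -> theta k <= x ->
  (b0%:E <= (x `^ (tau - 2))%:E *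
     \sum_(0 <= i <oo) (theta i * (x < theta i <= b1 * x)%R%:R)%:E)%E ->
  b0 <= x `^ (tau - 2) *
    \sum_(0 <= i < k) theta i * (x < theta i <= b1 * x)%R%:R.
Proof.
move=> th0 th_le kx.
rewrite (nneseries_split 0 k); last first.
  by move=> i _; rewrite lee_fin mulr_ge0.
rewrite add0n [X in (_ + X)%E]eseries0 ?adde0 ?sumEFin -?EFinM ?lee_fin//.
move=> i ki _; rewrite ltNge (le_trans (th_le _ _ ki) kx)/=.
by rewrite mulr0.
Qed.

Lemma powR_exprn (R : realType) (b a : R) (m : nat) : 0 <= b ->
  (b `^ a) ^+ m = (b ^+ m) `^ a.
Proof.
by move=> b0; rewrite -(powR_mulrn m b0) powRAC (powR_mulrn m (powR_ge0 b a)).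
Qed.

Lemma ler_sum_nat_term (R : realType) (F : nat -> R) (a b m : nat) :
  (a <= m < b)%N -> (forall i, 0 <= F i) -> F m <= \sum_(a <= i < b) F i.
Proof.
move=> /andP[am mb] F0; rewrite (big_cat_nat am (ltnW mb))/= (big_ltn mb).
have A0 : 0 <= \sum_(a <= i < m) F i by exact: sumr_ge0.
have B0 : 0 <= \sum_(m.+1 <= i < b) F i by exact: sumr_ge0.
lra.
Qed.

(** The mass is found in the filler, in one block, in vertex 0 alone, or in the head, according to
    [l]; the minimum collects the constants of these cases. In the window constant [2 * b1 + 4], the
    factor 2 pays for replacing $l/N$ by $\max(l/N,\theta_k)$, and the 4 leaves room for rounding
    and for the filler degree. *)
Lemma interpolates_power_law (R : realType) (tau b0 b1 C : R) (theta : nat -> R)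
    (n k M : nat) (d : n.-tuple nat) (l : R) :
  3 < tau < 4 -> (forall i, 0 < theta i) -> nonincreasing_seq theta ->
  0 < b0 -> 1 < b1 ->
  (forall x : R, 0 < x < theta 0%N ->
    (b0%:E <= (x `^ (tau - 2))%:E *
       \sum_(0 <= i <oo) (theta i * (x < theta i <= b1 * x)%R%:R)%:E)%E) ->
  theta k <= 2 -> interpolates R tau theta n k M d ->
  0 < C -> \sum_(x <- d) x%:R <= C * n%:R -> 1 <= l < deg R d 0 ->
  Num.min 2 (Num.min (theta 0%N `^ (tau - 1)) (b0 / 2 `^ (tau - 2))) / C
      / l `^ (tau - 2) * \sum_(x <- d) x%:R
    <= \sum_(x <- d) x%:R * (l < x%:R <= (2 * b1 + 4) * l)%R%:R.
Proof.
move=> tau34 th0 th_le b00 b11 pow thk2 I C0 dC /andP[l1 ld].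
have [kn N0 NM hX _] := interpolates_bounds _ _ _ _ _ _ _ th0 th_le I.
have [/andP[k0 kM] thk /andP[MN NM8] _ dE] := I.
have [q04 _] := exponent_bounds _ _ tau34.
set q := 2 `^ (1 - tau) in q04 dE.
rewrite /deg dE nth_degree_list//= in ld.
have nN : n%:R = vertex_scale R tau n `^ (tau - 1) :> R.
  by rewrite -powRrM mulVf ?powRr1//; lra.
set N := vertex_scale R tau n in N0 NM hX MN NM8 dE ld nN.
set h := fun i => even_above R (N * theta i) in dE.
have q01 : 0 <= q <= 1 by lra.
have [t2 t1] : 0 <= tau - 2 /\ 0 <= tau - 1 by split; lra.
have l0 : 0 < l by lra.
have lt0 : 0 < l `^ (tau - 2) by exact: powR_gt0.
have fit : (k + \sum_(1 <= m < M.+1) block_size R q n m <= n)%N.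
  by apply: block_sizes_fit kn; lra.
set W := (X in _ <= X); set c := Num.min 2 _.
(* The total degree is at most [C * n], so it suffices to compare with [n]. *)
suff cW : c * n%:R <= W * l `^ (tau - 2).
  have c0 : 0 <= c.
    by rewrite !le_min powR_ge0 divr_ge0 ?powR_ge0 ?(ltW b00)//= ler0n.
  apply: (@le_trans _ _ (c / C / l `^ (tau - 2) * (C * n%:R))).
    by rewrite ler_wpM2l// !divr_ge0// ltW.
  rewrite [leLHS](_ : _ = c * n%:R / l `^ (tau - 2)) ?ler_pdivrMr//.
  by field; rewrite !gt_eqF.
have c_le z : [|| z == 2, z == theta 0%N `^ (tau - 1) | z == b0 / 2 `^ (tau - 2)] ->
    z * n%:R <= W * l `^ (tau - 2) -> c * n%:R <= W * l `^ (tau - 2).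
  move=> zc; apply: le_trans; rewrite ler_wpM2r//.
  by case/or3P : zc => /eqP ->; rewrite !ge_min lexx ?orbT.
pose F x : R := x%:R * (l < x%:R <= (2 * b1 + 4) * l)%R%:R.
have F0 x : 0 <= F x by rewrite mulr_ge0.
have FE x : l < x%:R <= (2 * b1 + 4) * l -> F x = x%:R.
  by rewrite /F => ->; rewrite mulr1.
have WE : W = \sum_(0 <= i < k) F (h i)
      + \sum_(1 <= m < M.+1) (block_size R q n m)%:R * F (4 * 2 ^ m)%N
      + (n%:R - k%:R - \sum_(1 <= m < M.+1) (block_size R q n m)%:R) * F 4%N.
  by rewrite /W dE sum_degree_list.
have n4k : 4 * k%:R <= n%:R :> R by rewrite -natrM ler_nat.
have S_le : \sum_(1 <= m < M.+1) (block_size R q n m)%:R <= n%:R / 4 :> R.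
  apply: le_trans (sum_block_size_le R q n M q01) _.
  by rewrite ler_wpM2l//; lra.
have R0 : n%:R / 2 <= n%:R - k%:R - \sum_(1 <= m < M.+1) (block_size R q n m)%:R :> R.
  by lra.
have n0 : 0 <= n%:R :> R by [].
have head0 : 0 <= \sum_(0 <= i < k) F (h i) by exact: sumr_ge0.
have blocks0 : 0 <= \sum_(1 <= m < M.+1) (block_size R q n m)%:R * F (4 * 2 ^ m)%N.
  by apply: sumr_ge0 => m _; rewrite mulr_ge0.
have tail0 : 0 <= (n%:R - k%:R - \sum_(1 <= m < M.+1) (block_size R q n m)%:R) * F 4%N.
  by rewrite mulr_ge0//; lra.
have [lM|Ml] := ltP l (4 * 2 ^ M)%N%:R.
  apply: (c_le 2); first by rewrite eqxx.
  (* Below 4 the filler suffices: it has at least $n/2$ vertices, of total degree at least $2n$. *)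
  have [l4|l4] := ltP l 4.
    have F4 : F 4%N = 4 by apply: FE; rewrite l4/=; nra.
    have W2 : 2 * n%:R <= W by rewrite WE F4; lra.
    have lt1 : 1 <= l `^ (tau - 2).
      by rewrite -[leLHS](powRr0 l) ler_powR//; lra.
    by apply: le_trans W2 _; rewrite ler_peMr//; lra.
  (* The block used is the first one whose value exceeds [l]; minimality of [m] bounds that value by
     $2l$. *)
  have [m /andP[m0 mM] /andP[ml lm]] : exists2 m, (0 < m <= M)%N &
      (2 ^ m)%N%:R *+ 2 <= l < (4 * 2 ^ m)%N%:R.
    have ex : exists m, l < (4 * 2 ^ m)%N%:R by exists M.
    have [m lm m_min] := ex_minnP ex; exists m.
      rewrite m_min// andbT lt0n; apply/eqP => m00; move: lm.
      by rewrite m00 expn0 muln1; lra.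
    rewrite lm andbT leNgt; apply/negP => l_lt.
    case: m lm m_min l_lt => [|m] lm m_min l_lt.
      by move: lm; rewrite expn0 muln1; lra.
    suff /m_min : l < (4 * 2 ^ m)%N%:R by rewrite ltnn.
    by move: l_lt; rewrite -mulr_natr -natrM expnS mulnC mulnA.
  have Fm : F (4 * 2 ^ m)%N = (4 * 2 ^ m)%N%:R.
    apply: FE; rewrite lm/=; move: ml; rewrite -mulr_natl natrM => ml.
    have : 0 <= (2 ^ m)%N%:R :> R by [].
    by nra.
  set p : R := 2 ^+ m.
  have pE : (2 ^ m)%N%:R = p by rewrite natrX.
  have p1 : 1 <= p by rewrite exprn_ege1//; lra.
  have p0 : 0 < p by lra.
  have pM : p <= 2 ^+ M by rewrite ler_eXn2l//; lra.
  have qm : q ^+ m = p `^ (1 - tau).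
    exact: powR_exprn.
  have pl : p <= l by move: ml; rewrite pE -mulr_natl; lra.
  have npq : n%:R * p `^ (1 - tau) = (N / p) `^ (tau - 1).
    rewrite powRM ?invr_ge0 ?(ltW N0) ?(ltW p0)// nN; congr (_ * _).
    by rewrite -opprB powRN -[in RHS](powR_inv1 (ltW p0)) -powRrM mulN1r powRN.
  (* From $4\cdot2^M\le N\theta_k\le2N$. It gives $nq^m\ge4$, so rounding leaves block [m] with at
     least $nq^m/2$ vertices. *)
  have Np2 : 2 <= N / p.
    rewrite ler_pdivlMr//.
    move: MN; rewrite natrM natrX => MN.
    have : N * theta k <= N * 2 by rewrite ler_wpM2l// ltW.
    lra.
  have npq4 : 4 <= n%:R * p `^ (1 - tau).
    rewrite npq; apply: (@le_trans _ _ ((N / p) ^+ 2)); first by rewrite expr2; nra.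
    by rewrite -powR_mulrn ?(le_trans _ Np2)// ler_powR ?(le_trans _ Np2)//; lra.
  have block_ge : n%:R * p `^ (1 - tau) / 2 <= (block_size R q n m)%:R.
    have /andP[+ _] := block_size_itv R q n m q01; rewrite qm; apply: le_trans.
    by nra.
  have W_ge : (block_size R q n m)%:R * (4 * p) <= W.
    rewrite WE -addrA ler_wpDl// ler_wpDr//.
    rewrite -pE -natrM -Fm.
    apply: (@ler_sum_nat_term _ (fun m => (block_size R q n m)%:R * F (4 * 2 ^ m)%N)).
      by rewrite m0.
    by move=> i; rewrite mulr_ge0.
  have pp : p `^ (1 - tau) * p * p `^ (tau - 2) = 1.
    rewrite -[X in _ * X * _](powRr1 (ltW p0)).
    rewrite -!powRD ?(gt_eqF p0) ?implybT//.
    by rewrite (_ : _ + _ = 0) ?powRr0//; ring.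
  have plt : p `^ (tau - 2) <= l `^ (tau - 2).
    by rewrite ge0_ler_powR ?nnegrE ?(ltW p0) ?(ltW l0).
  apply: (@le_trans _ _ (n%:R * p `^ (1 - tau) / 2 * (4 * p) * p `^ (tau - 2))).
    rewrite [leRHS](_ : _ = 2 * n%:R * (p `^ (1 - tau) * p * p `^ (tau - 2))); last by field.
    by rewrite pp mulr1.
  apply: ler_pM => //; [|exact: powR_ge0|].
    by rewrite !mulr_ge0 ?powR_ge0 ?invr_ge0 ?(ltW p0).
  by apply: le_trans W_ge; rewrite ler_wpM2r// mulr_ge0 ?(ltW p0).
have hN i : N * theta i < (h i)%:R <= N * theta i + 2.
  by apply: even_above_itv; rewrite mulr_ge0 ?ltW.
(* When $N\theta_0\le l<d_1$, the hypothesis on [theta] says nothing at $l/N$, but vertex 0 alone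
   weighs more than [l], and $l^{\tau-1}\ge n\theta_0^{\tau-1}$. *)
have [ltheta|thetal] := leP (N * theta 0%N) l.
  apply: (c_le (theta 0%N `^ (tau - 1))); first by rewrite eqxx orbT.
  have Fh : F (h 0%N) = (h 0%N)%:R.
    apply: FE; rewrite ld/=; have /andP[_ h2] := hN 0%N.
    by apply: le_trans h2 _; nra.
  have lW : l <= W.
    rewrite WE -addrA ler_wpDr ?addr_ge0// big_ltn// ler_wpDr ?sumr_ge0//.
    by rewrite Fh ltW.
  apply: le_trans (ler_wpM2r (ltW lt0) lW).
  rewrite -[X in _ <= X * _](powRr1 (ltW l0)) -powRD; last first.
    by apply/implyP => _; rewrite gt_eqF.
  rewrite mulrC nN -powRM ?(ltW N0) ?(ltW (th0 _))//.
  have -> : 1 + (tau - 2) = tau - 1 by lra.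
  by rewrite ge0_ler_powR ?nnegrE ?mulr_ge0 ?(ltW N0) ?(ltW (th0 _)) ?(ltW l0).
apply: (c_le (b0 / 2 `^ (tau - 2))); first by rewrite eqxx !orbT.
(* Taking x >= theta k restricts the sum over theta to the first k vertices;   *)
(* since N * theta k < 8 * 2 ^ M <= 2 * l, this costs only a factor 2.          *)
set x := Num.max (l / N) (theta k).
have Nx : N * x = Num.max l (N * theta k).
  by rewrite maxr_pMr ?(ltW N0)// mulrCA divff ?mulr1// gt_eqF.
have lx : l <= N * x by rewrite Nx le_max lexx.
have x2l : N * x <= 2 * l.
  rewrite Nx ge_max; apply/andP; split; first by lra.
  by apply: le_trans (ltW NM8) _; move: Ml; rewrite !natrM; lra.
have x0 : 0 < x by rewrite lt_max th0 orbT.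
have xth : x < theta 0%N by rewrite gt_max thk andbT ltr_pdivrMr// mulrC.
have kx : theta k <= x by rewrite le_max lexx orbT.
have := @truncate_power_law R tau b0 b1 x theta k (fun i => ltW (th0 i)) th_le kx.
have x0th : 0 < x < theta 0%N by rewrite x0.
move=> /(_ (pow x x0th)); set S := \sum_(0 <= i < k) _ => bS.
have NSW : N * S <= W.
  rewrite WE -addrA ler_wpDr ?addr_ge0// mulr_sumr; apply: ler_sum => i _.
  have [xi|_] := boolP (x < theta i <= b1 * x); last by rewrite !mulr0.
  rewrite mulr1; have /andP[h1 h2] := hN i; move/andP: xi => [xi1 xi2].
  rewrite FE; first exact: ltW.
  have Nxi : N * x < N * theta i by rewrite ltr_pM2l.
  have Nxi2 : N * theta i <= b1 * (N * x) by rewrite mulrCA ler_pM2l.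
  have : b1 * (N * x) <= b1 * (2 * l) by rewrite ler_wpM2l//; lra.
  by move=> ?; apply/andP; split; nra.
have xl : x `^ (tau - 2) <= (2 * l / N) `^ (tau - 2).
  rewrite ge0_ler_powR ?nnegrE ?divr_ge0 ?mulr_ge0 ?(ltW N0) ?(ltW x0) ?(ltW l0)//.
  by rewrite ler_pdivlMr// mulrC.
have S0 : 0 <= S by apply: sumr_ge0 => i _; rewrite mulr_ge0// ltW.
(* As $N^{\tau-1}=n$, the factor $N^{-(\tau-2)}$ equals $N/n$; its numerator turns the sum over
   [theta] into a sum of degrees. *)
have xlE : (2 * l / N) `^ (tau - 2) = 2 `^ (tau - 2) * l `^ (tau - 2) * N / n%:R.
  rewrite nN powRM ?mulr_ge0 ?invr_ge0 ?(ltW N0) ?(ltW l0)//.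
  rewrite powRM ?(ltW l0)//.
  rewrite (_ : N^-1 `^ _ = (N `^ (tau - 2))^-1); last first.
    by rewrite -(powR_inv1 (ltW N0)) -powRrM mulN1r powRN.
  have -> : N `^ (tau - 1) = N * N `^ (tau - 2).
    rewrite (_ : tau - 2 = tau - 1 - 1); last by ring.
    by rewrite mulr_powRB1 ?(ltW N0)//; lra.
  have Np : N `^ (tau - 2) != 0 by rewrite gt_eqF// powR_gt0.
  by field; rewrite Np gt_eqF.
have np : 0 < n%:R :> R by rewrite nN powR_gt0.
rewrite mulrAC ler_pdivrMr ?powR_gt0//.
have : b0 <= 2 `^ (tau - 2) * l `^ (tau - 2) * N / n%:R * S.
  by apply: le_trans bS _; rewrite -xlE ler_wpM2r.
rewrite [X in _ <= X -> _](_ : _ =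
  2 `^ (tau - 2) * l `^ (tau - 2) * (N * S) / n%:R); last first.
  by field; rewrite gt_eqF.
rewrite ler_pdivlMr// => /le_trans; apply.
rewrite [leRHS](_ : _ = 2 `^ (tau - 2) * l `^ (tau - 2) * W); last by ring.
by rewrite ler_wpM2l// mulr_ge0// powR_ge0.
Qed.

(** * Passage to the limit along the sequence *)

Lemma cvg_EFin_seq (R : realType) (u : nat -> R) (s : R) :
  u n @[n --> \oo] --> s -> (u n)%:E @[n --> \oo] --> s%:E.
Proof. by move=> us; apply: cvg_EFin => //; exact: nearW. Qed.

Lemma assumption1_ii_interpolates (R : realType) (tau : R) (theta : nat -> R)
    (d : forall n, n.-tuple nat) (kappa M : nat -> nat) :
  3 < tau < 4 -> (forall i, 0 < theta i) -> nonincreasing_seq theta ->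
  theta n @[n --> \oo] --> (0 : R) ->
  (\sum_(0 <= i <oo) (theta i ^+ 3)%:E < +oo)%E ->
  kappa n @[n --> \oo] --> \oo ->
  (\forall n \near \oo, interpolates R tau theta n (kappa n) (M n) (d n)) ->
  assumption1_ii tau d.
Proof.
move=> tau34 th0 th_le th_cvg th3 kappa_oo nearI; split; last first.
  exact: third_moment_tail tau34 th0 th_le th_cvg th3 kappa_oo nearI.
have [P [mu [mu2 [D_cvg muE mu2E mu_cvg mu2_cvg]]]] :=
  interpolates_moments _ _ _ _ _ _ tau34 th0 th_le kappa_oo nearI.
exists _, nat, P, (dyadic_degree R), mu, mu2; split => //.
- apply: cvg_trans (cvg_EFin_seq _ _ _ mu_cvg); apply: near_eq_cvg; near=> n.
  have n0 : (0 < n)%N by near: n; exact: nbhs_infty_gt.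
  by rewrite (@expectation_uniform_degree R n (d n) (fun x => x%:R)).
- apply: cvg_trans (cvg_EFin_seq _ _ _ mu2_cvg); apply: near_eq_cvg; near=> n.
  have n0 : (0 < n)%N by near: n; exact: nbhs_infty_gt.
  by rewrite (@expectation_uniform_degree R n (d n) (fun x => x%:R ^+ 2)).
Unshelve. all: by end_near. Qed.

Lemma interpolates_degree_ge4 (R : realType) (tau : R) (theta : nat -> R)
    (n k M : nat) (d : seq nat) :
  (forall i, 0 < theta i) -> nonincreasing_seq theta ->
  interpolates R tau theta n k M d -> forall x, x \in d -> (4 <= x)%N.
Proof.
move=> th0 th_le I; have [_ N0 NM _ _] := interpolates_bounds _ _ _ _ _ _ _ th0 th_le I.
have [_ _ _ _ ->] := I; apply/allP/degree_list_ge4 => i ik.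
have /even_above_itv/andP[/ltW h1 _] : 0 <= vertex_scale R tau n * theta i.
  by rewrite mulr_ge0// ltW.
rewrite -(ler_nat R); apply: le_trans h1; apply: le_trans (NM _ ik).
by rewrite ler_nat leq_pmulr// expn_gt0.
Qed.

(** The limit is $\mu_2/\mu-1$. Since every degree is eventually at least 4, $\mu_2\ge4\mu>0$ and
    the limit is at least 3. *)
Lemma branching_ratio_cvg (R : realType) (tau : R) (theta : nat -> R)
    (d : forall n, n.-tuple nat) (kappa M : nat -> nat) :
  3 < tau < 4 -> (forall i, 0 < theta i) -> nonincreasing_seq theta ->
  kappa n @[n --> \oo] --> \oo ->
  (\forall n \near \oo, interpolates R tau theta n (kappa n) (M n) (d n)) ->
  exists nu : R, 1 < nu /\
    (\sum_(i < n) deg R (d n) i * (deg R (d n) i - 1)) /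
    (\sum_(i < n) deg R (d n) i) @[n --> \oo] --> nu.
Proof.
move=> tau34 th0 th_le kappa_oo nearI.
have [_ [mu [mu2 [_ _ _ mu_cvg mu2_cvg]]]] :=
  interpolates_moments _ _ _ _ _ _ tau34 th0 th_le kappa_oo nearI.
have near4 : \forall n \near \oo, (0 < n)%N /\ forall x, x \in tval (d n) -> (4 <= x)%N.
  near=> n; split; first by near: n; exact: nbhs_infty_gt.
  have I : interpolates R tau theta n (kappa n) (M n) (d n) by near: n.
  exact: interpolates_degree_ge4 th0 th_le I.
have mu4 : 4 <= mu.
  apply: (ler_cvg_to (cvg_cst (4 : R)) mu_cvg); near=> n.
  have [n0 d4] : (0 < n)%N /\ forall x, x \in tval (d n) -> (4 <= x)%N by near: n.
  rewrite ler_pdivlMl ?ltr0n// -sum_nth_tuple.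
  rewrite mulr_natl -[X in _ *+ X]card_ord -sumr_const.
  apply: ler_sum => i _; rewrite (ler_nat R 4); apply: d4.
  by rewrite mem_nth ?size_tuple.
have mu24 : 4 * mu <= mu2.
  apply: (ler_cvg_to (cvgMr mu_cvg : _ --> 4 * mu) mu2_cvg); near=> n.
  have [n0 d4] : (0 < n)%N /\ forall x, x \in tval (d n) -> (4 <= x)%N by near: n.
  rewrite mulrCA ler_wpM2l ?invr_ge0// mulr_sumr.
  rewrite big_seq [leRHS]big_seq; apply: ler_sum => x xd.
  by rewrite expr2 ler_wpM2r// (ler_nat R 4) d4.
exists ((mu2 - mu) / mu); split; first by rewrite ltr_pdivlMr; lra.
have mu0 : mu != 0 by lra.
pose m1 n : R := n%:R^-1 * \sum_(x <- d n) x%:R.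
pose m2 n : R := n%:R^-1 * \sum_(x <- d n) x%:R ^+ 2.
have ratio_cvg : (m2 n - m1 n) / m1 n @[n --> \oo] --> (mu2 - mu) / mu.
  exact: cvgM (cvgB mu2_cvg mu_cvg) (cvgV mu0 mu_cvg).
apply: cvg_trans ratio_cvg; apply: near_eq_cvg; near=> n.
have n0 : n%:R != 0 :> R by rewrite pnatr_eq0 -lt0n; near: n; exact: nbhs_infty_gt.
rewrite /m1 /m2 -mulrBr invfM invrK mulrACA mulVf// mul1r.
rewrite -(@sum_nth_tuple R n (d n) (fun x => x%:R)).
rewrite -(@sum_nth_tuple R n (d n) (fun x => x%:R ^+ 2)) -sumrB.
by congr (_ / _); apply: eq_bigr => i _; rewrite /deg mulrBr mulr1 expr2.
Unshelve. all: by end_near. Qed.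

Lemma near_power_law (R : realType) (tau b0 b1 : R) (theta : nat -> R)
    (d : forall n, n.-tuple nat) (kappa M : nat -> nat) :
  3 < tau < 4 -> (forall i, 0 < theta i) -> nonincreasing_seq theta ->
  theta n @[n --> \oo] --> (0 : R) ->
  0 < b0 -> 1 < b1 ->
  (forall x : R, 0 < x < theta 0%N ->
    (b0%:E <= (x `^ (tau - 2))%:E *
       \sum_(0 <= i <oo) (theta i * (x < theta i <= b1 * x)%R%:R)%:E)%E) ->
  kappa n @[n --> \oo] --> \oo ->
  (\forall n \near \oo, interpolates R tau theta n (kappa n) (M n) (d n)) ->
  exists c0 c1 : R, [/\ 0 < c0, 1 < c1 & \forall n \near \oo,
    (0 < sumn (d n))%N /\
    forall l : R, 1 <= l -> l < deg R (d n) 0 ->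
      ((c0 / l `^ (tau - 2))%:E <=
       size_biased_vertex R (d n) [set v | (l < deg R (d n) v <= c1 * l)%R])%E].
Proof.
move=> tau34 th0 th_le th_cvg b00 b11 pow kappa_oo nearI.
have [_ [mu [_ [_ _ _ mu_cvg _]]]] :=
  interpolates_moments _ _ _ _ _ _ tau34 th0 th_le kappa_oo nearI.
(* Any constant above the limiting mean degree eventually bounds the mean degree; the absolute value
   makes positivity immediate. *)
pose C := `|mu| + 1; have C0 : 0 < C by rewrite ltr_wpDl.
have nearC : \forall n \near \oo, \sum_(x <- d n) x%:R <= C * n%:R.
  near=> n; rewrite mulrC -ler_pdivrMl ?ltr0n//; last by near: n; exact: nbhs_infty_gt.
  near: n; have /cvgr_le := mu_cvg; apply.
  by rewrite /C; have := ler_norm mu; lra.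
exists (Num.min 2 (Num.min (theta 0%N `^ (tau - 1)) (b0 / 2 `^ (tau - 2))) / C),
  (2 * b1 + 4); split; [|lra|].
  by rewrite divr_gt0// !lt_min powR_gt0// divr_gt0 ?powR_gt0// ltr0n.
near=> n.
have I : interpolates R tau theta n (kappa n) (M n) (d n) by near: n.
have n0 : (0 < n)%N by near: n; exact: nbhs_infty_gt.
have th2 : theta (kappa n) <= 2.
  near: n; apply: (kappa_oo (fun k => theta k <= 2)).
  by have /cvgr_le := th_cvg; exact.
have dC : \sum_(x <- d n) x%:R <= C * n%:R by near: n.
have d0 : (0 < sumn (d n))%N.
  have := interpolates_degree_ge4 _ _ _ _ _ _ _ th0 th_le I.
  case: (tval (d n)) (size_tuple (d n)) => [/= n00|x s _ d4].
    by rewrite -n00 in n0.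
  by rewrite /= addn_gt0 (leq_trans _ (d4 x (mem_head x s))).
split => // l l1 ld; rewrite size_biased_vertexE// lee_fin ler_pdivlMr; last first.
  by rewrite -natr_sum -sumnE ltr0n.
apply: interpolates_power_law tau34 th0 th_le b00 b11 pow th2 I C0 dC _.
by rewrite l1.
Unshelve. all: by end_near. Qed.

(** * Small [n], positivity and decay of [theta], and conclusion *)

Lemma assumption2_nseq2 (R : realType) (tau : R) (n : nat) (l c0 c1 : R) :
  2 < tau -> 0 < c0 <= 1 -> 2 <= c1 -> 1 <= l -> l < 2 -> (0 < n)%N ->
  ((c0 / l `^ (tau - 2))%:E <=
     size_biased_vertex R (nseq_tuple n 2%N)
       [set v | (l < deg R (nseq_tuple n 2%N) v <= c1 * l)%R])%E.
Proof.
move=> tau2 /andP[c00 c01] c12 l1 l2 n0.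
have d0 : (0 < sumn (nseq n 2))%N by rewrite sumn_nseq muln_gt0.
rewrite size_biased_vertexE//= lee_fin !big_nseq !iter_addr_0.
(* Every vertex falls in the window, so its size-biased mass is 1. *)
have -> : l < 2 <= c1 * l by rewrite l2/=; nra.
have n2 : (2 : R) *+ n != 0 by rewrite mulrn_eq0 negb_or -lt0n n0 pnatr_eq0.
have l0 : 0 < l by lra.
rewrite mulr1 (divff n2) ler_pdivrMr ?powR_gt0// mul1r.
apply: le_trans c01 _; rewrite -[leLHS](powRr0 l) ler_powR//; lra.
Qed.

Lemma ell_down_cvg0 (R : realType) (theta : nat -> R) (p : nat) :
  (0 < p)%N -> ell_down p theta -> theta n @[n --> \oo] --> (0 : R).
Proof.
move=> p0 [th0 th_le sum_fin].
have pow_cvg : theta n ^+ p @[n --> \oo] --> (0 : R).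
  apply: cvg_series_cvg_0; apply: nnseries_is_cvg => //.
  by move=> n; rewrite exprn_ge0.
apply/cvgr0Pnorm_lt => e e0.
have /cvgr0Pnorm_lt /(_ (e ^+ p) (exprn_gt0 _ e0)) := pow_cvg.
apply: filterS => n; rewrite !ger0_norm ?exprn_ge0//.
by rewrite ltr_pXn2r ?nnegrE// ltW.
Qed.

(** A non-increasing non-negative sequence with a zero entry is finitely supported, hence summable
    to every positive power. *)
Lemma ell_down_gt0 (R : realType) (theta : nat -> R) (p r : nat) :
  (0 < r)%N -> (ell_down p `\` ell_down r) theta -> forall i, 0 < theta i.
Proof.
move=> r0 [[th0 th_le _] not_r] i; rewrite lt_neqAle th0 andbT.
apply/eqP => thi0; apply: not_r; split => //.
rewrite (nneseries_split 0 i) => [|j _]; last by rewrite lee_fin exprn_ge0.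
rewrite eseries0 ?adde0 ?sumEFin ?ltry// => j ij _.
have -> : theta j = 0.
  by apply/eqP; rewrite eq_le th0 andbT thi0; apply: th_le; rewrite add0n in ij.
by rewrite expr0n -(prednK r0).
Qed.

Theorem proposition1p6 (R : realType) (tau : R) (theta : nat -> R)
    (htau : 3 < tau < 4)
    (htheta : (ell_down 3 `\` ell_down 2) theta)
    (hpow : exists c0 c1 : R, [/\ 0 < c0, 1 < c1 &
      forall x : R, 0 < x < theta 0%N ->
        (c0%:E <= (x `^ (tau - 2))%:E *
           \sum_(0 <= i <oo)
             (theta i * (x < theta i <= c1 * x)%R%:R)%:E)%E]) :
  exists d : forall n : nat, n.-tuple nat,
    [/\ forall n : nat, degree_sequence (d n),
        assumption1_i tau theta d,
        assumption1_ii tau d,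
        assumption2 tau d &
        exists nu : R, 1 < nu /\
          (\sum_(i < n) deg R (d n) i * (deg R (d n) i - 1)) /
          (\sum_(i < n) deg R (d n) i) @[n --> \oo] --> nu].
Proof.
have th0 := ell_down_gt0 _ _ _ _ (isT : (0 < 2)%N) htheta.
have [ell3 _] := htheta; have [_ th_le th3] := ell3.
have th_cvg := ell_down_cvg0 _ _ _ (isT : (0 < 3)%N) ell3.
have [b0 [b1 [b00 b11 pow]]] := hpow.
have [d [kappa [M [d_deg kappa_oo nearI]]]] :=
  exists_interpolation _ _ _ htau th0 th_le th_cvg.
have [c0 [c1 [c00 c11 [n0 _ n0P]]]] := near_power_law _ _ _ _ _ _ _ _ htau th0
  th_le th_cvg b00 b11 pow kappa_oo nearI.
(* Finitely many terms are replaced so that the eventual size-biased bound     *)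
(* holds for all n.                                                            *)
pose d' n := if (n < n0)%N then nseq_tuple n 2%N else d n.
have nearI' : \forall n \near \oo, interpolates R tau theta n (kappa n) (M n) (d' n).
  near=> n; rewrite /d' ltnNge ifF; first by near: n.
  by apply/negbF; near: n; exact: nbhs_infty_ge.
exists d'; split.
- by move=> n; rewrite /d'; case: ifP => // _; exact: degree_sequence_nseq2.
- by apply: assumption1_i_interpolates th0 th_le kappa_oo nearI'; lra.
- exact: assumption1_ii_interpolates htau th0 th_le th_cvg th3 kappa_oo nearI'.
(* The cap 1 and the floor 2 serve the constant sequences; lowering [c0] and widening the window
   preserves the bound for the other [n]. *)
- exists (Num.min c0 1), (Num.max c1 2); split.
  + by rewrite lt_min c00 ltr01.
  + by rewrite lt_max c11.
  + move=> n n1; rewrite /d'; case: (ltnP n n0) => nn0.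
      split; first by rewrite /= sumn_nseq muln_gt0.
      move=> l l1; rewrite {1}/deg /= nth_nseq n1 => l2.
      apply: assumption2_nseq2 => //; first by lra.
        by rewrite ge_min lexx orbT lt_min c00 ltr01.
      by rewrite le_max lexx orbT.
    have [d0 dP] := n0P n nn0; split => // l l1 ld.
    apply: (@le_trans _ _ (c0 / l `^ (tau - 2))%:E).
      by rewrite lee_fin ler_wpM2r ?invr_ge0 ?powR_ge0// ge_min lexx.
    apply: le_trans (dP l l1 ld) _; apply: le_measure; rewrite ?inE// => v /=.
    move=> /andP[-> /= vl]; apply: le_trans vl _; rewrite ler_wpM2r//; last first.
      by rewrite le_max lexx.
    by lra.
- exact: branching_ratio_cvg htau th0 th_le kappa_oo nearI'.
Unshelve. all: by end_near. Qed.
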